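(* Let $k$ be an algebraically closed field, let $m\ge 2$, and let $C=\mathcal Z(f)\subset\mathbb P^2$ be an irreducible plane curve of odd degree $d=2m-1$, defined by an irreducible homogeneous polynomial $f\in k[x_0,x_1,x_2]$ of degree $2m-1$. Let $\sigma:\mathbb P^2\to\mathbb P^5$ be the Veronese embedding, let $S=k[x_{00},x_{01},x_{02},x_{11},x_{12},x_{22}]$, and let $\mathcal I_C\subset S$ be the homogeneous ideal of $\sigma(C)$. Then $S/\mathcal I_C$ has a graded free resolution over $S$ (an exact sequence of graded $S$-modules with degree-$0$ maps) of the form $$0\to S(-m-4)\xrightarrow{\beta_4} S(-4)^{\oplus 3}\oplus S(-m-2)^{\oplus 6}\xrightarrow{\beta_3} S(-3)^{\oplus 8}\oplus S(-m-1)^{\oplus 8}\xrightarrow{\beta_2} S(-2)^{\oplus 6}\oplus S(-m)^{\oplus 3}\xrightarrow{\beta_1} S\to S/\mathcal I_C\to 0.$$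
   Context: $S=k[x_{00},x_{01},x_{02},x_{11},x_{12},x_{22}]$ has the standard grading, and $S(e)$ is the graded module with $S(e)_n=S_{e+n}$. The Veronese embedding is $\sigma(a_0,a_1,a_2)=(a_0^2,a_0a_1,a_0a_2,a_1^2,a_1a_2,a_2^2)$, where $x_{00},x_{01},x_{02},x_{11},x_{12},x_{22}$ are the corresponding homogeneous coordinates on $\mathbb P^5$. The homogeneous ideal $\mathcal I_C$ of $\sigma(C)$ is the ideal generated by all homogeneous elements of $S$ vanishing on $\sigma(C)$. *)

(* Defs.v *)
From HB Require Import structures.
From mathcomp Require Import all_boot all_order all_algebra.
From mathcomp Require Import generic_quotient ring_quotient.
From mathcomp Require Import boolp.
From mathcomp Require Import mpoly.

Set Implicit Arguments.
Unset Strict Implicit.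
Unset Printing Implicit Defensive.

Import GRing.Theory.
Local Open Scope ring_scope.
Local Open Scope quotient_scope.

Section Graded.
Variables (k : fieldType) (n : nat).
Local Notation S := {mpoly k[n]}.

(* The homogeneous part S_e of degree e, which is 0 for e < 0. *)
Definition homog_part (e : int) (p : S) : Prop :=
  match e with
  | Posz d => p \is d.-homog
  | Negz _ => p = 0
  end.

(* [gm_gen] and [gm_uniq] together say that M is the internal direct sum of
   its homogeneous parts [gm_part e]. *)
Record gradedMod := GradedMod {
  gm_sort :> lmodType S;
  gm_part : int -> gm_sort -> Prop;
  gm_part0 : forall e, gm_part e 0;
  gm_partB : forall e x y, gm_part e x -> gm_part e y -> gm_part e (x - y);
  gm_partZ : forall d e (p : S) x,
    homog_part d p -> gm_part e x -> gm_part (d + e) (p *: x);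
  gm_gen : forall x, exists (s : seq int) (c : int -> gm_sort),
    [/\ uniq s, forall e, gm_part e (c e) & x = \sum_(e <- s) c e];
  gm_uniq : forall (s : seq int) (c : int -> gm_sort),
    uniq s -> (forall e, gm_part e (c e)) -> \sum_(e <- s) c e = 0 ->
    forall e, e \in s -> c e = 0
}.

Definition degree0 (M N : gradedMod) (h : M -> N) : Prop :=
  forall e x, gm_part e x -> gm_part e (h x).

Definition exact_at (L M N : lmodType S) (g : L -> M) (h : M -> N) : Prop :=
  forall y : M, h y = 0 <-> exists x : L, g x = y.

Lemma homog_part_coeffP e (p : S) :
  homog_part e p <-> (forall m, e != (mdeg m)%:Z -> p@_m = 0).
Proof.
case: e => d /=; split.
- by move=> hp m ne; apply: (dhomog_nemf_coeff hp); rewrite eq_sym -eqz_nat.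
- move=> h; apply/dhomogP => m; rewrite mcoeff_msupp => pm.
  apply/eqP; rewrite -eqz_nat eq_sym; apply/negPn/negP => /h.
  by move/eqP; rewrite (negPf pm).
- by move=> -> m _; rewrite mcoeff0.
- by move=> h; apply/mpolyP => m; rewrite mcoeff0 h.
Qed.

Lemma homog_part0 e : homog_part e 0.
Proof. by apply/homog_part_coeffP => m _; rewrite mcoeff0. Qed.

Lemma homog_partD e p q :
  homog_part e p -> homog_part e q -> homog_part e (p + q).
Proof.
move=> /homog_part_coeffP hp /homog_part_coeffP hq.
by apply/homog_part_coeffP => m ne; rewrite mcoeffD hp // hq // addr0.
Qed.

Lemma homog_partB e p q :
  homog_part e p -> homog_part e q -> homog_part e (p - q).
Proof.
move=> /homog_part_coeffP hp /homog_part_coeffP hq.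
by apply/homog_part_coeffP => m ne; rewrite mcoeffB hp // hq // subr0.
Qed.

Lemma homog_partM d e p q :
  homog_part d p -> homog_part e q -> homog_part (d + e) (p * q).
Proof.
case: d => d hp hq; last by rewrite hp mul0r; exact: homog_part0.
case: e hq => e hq; last by rewrite hq mulr0; exact: homog_part0.
exact: dhomogM hp hq.
Qed.

Definition hcomp (e : int) (p : S) : S :=
  match e with
  | Posz d => pihomog mdeg d p
  | Negz _ => 0
  end.

Lemma hcompP e p : homog_part e (hcomp e p).
Proof. by case: e => d //=; exact: pihomogP. Qed.

Lemma mcoeff_hcomp e p m : (hcomp e p)@_m = if e == (mdeg m)%:Z then p@_m else 0.
Proof.
case: e => d /=; last by rewrite mcoeff0.
rewrite pihomogE raddf_sum /= eqz_nat.
under eq_bigr do rewrite mcoeffZ mcoeffX.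
have [ms|ms] := boolP (m \in msupp p); last first.
  rewrite big1_seq; first by case: ifP => // _; rewrite memN_msupp_eq0.
  move=> m' /andP[_ ms']; case: eqP => [E|_]; last by rewrite mulr0.
  by rewrite -E ms' in ms.
rewrite big_mkcond (bigD1_seq m) //= eqxx mulr1 eq_sym.
rewrite big1 ?addr0 // => m' ne; case: ifP => // _.
by rewrite (negPf ne) mulr0.
Qed.

Lemma sum_hcomp (e : int) (s : seq int) p : uniq s ->
  (forall m, m \in msupp p -> (mdeg m)%:Z - e \in s) ->
  \sum_(d <- s) hcomp (e + d) p = p.
Proof.
move=> us hs; apply/mpolyP => m; rewrite raddf_sum /=.
under eq_bigr do rewrite mcoeff_hcomp.
have [ms|ms] := boolP (m \in msupp p); last first.
  by rewrite big1 ?memN_msupp_eq0 // => d _; case: ifP.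
rewrite (bigD1_seq ((mdeg m)%:Z - e)) ?hs //= [e + _]addrC subrK eqxx.
rewrite big1 ?addr0 // => d ne; case: eqP => // E.
by rewrite -E [e + d]addrC addrK eqxx in ne.
Qed.

Lemma sum_homog_eq0 (e : int) (s : seq int) (c : int -> S) : uniq s ->
  (forall d, homog_part (e + d) (c d)) -> \sum_(d <- s) c d = 0 ->
  forall d, d \in s -> c d = 0.
Proof.
move=> us hc s0 d ds; apply/mpolyP => m; rewrite mcoeff0.
have [E|ne] := eqVneq (e + d) (mdeg m)%:Z; last first.
  by move/homog_part_coeffP: (hc d); apply.
have := congr1 (mcoeff m) s0; rewrite raddf_sum mcoeff0 /=.
rewrite (bigD1_seq d) //= big1 ?addr0 // => d' ne.
move/homog_part_coeffP: (hc d'); apply; rewrite -E.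
by rewrite (inj_eq (addrI e)).
Qed.

Lemma hcomp_id e p : homog_part e p -> hcomp e p = p.
Proof.
move=> /homog_part_coeffP h; apply/mpolyP => m; rewrite mcoeff_hcomp.
by case: eqP => // /eqP ne; rewrite h.
Qed.

Lemma hcomp_eq0 e d p : homog_part d p -> e != d -> hcomp e p = 0.
Proof.
move=> /homog_part_coeffP h ne; apply/mpolyP => m; rewrite mcoeff_hcomp mcoeff0.
by case: eqP => // E; rewrite h // -E eq_sym.
Qed.

Lemma hcomp_sum e (I : Type) (r : seq I) (F : I -> S) :
  hcomp e (\sum_(i <- r) F i) = \sum_(i <- r) hcomp e (F i).
Proof. by case: e => d /=; [rewrite raddf_sum | rewrite big1]. Qed.

Definition mdegs (p : S) : seq int := undup [seq (mdeg m)%:Z | m <- msupp p].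

Lemma sum_hcomp_mdegs p : \sum_(d <- mdegs p) hcomp d p = p.
Proof.
transitivity (\sum_(d <- mdegs p) hcomp (0 + d) p).
  by apply: eq_bigr => d _; rewrite add0r.
apply: sum_hcomp; first exact: undup_uniq.
by move=> m ms; rewrite subr0 mem_undup map_f.
Qed.

Lemma ring_gen (x : S^o) : exists (s : seq int) (c : int -> S^o),
  [/\ uniq s, forall e, homog_part e (c e) & x = \sum_(e <- s) c e].
Proof.
exists (mdegs x), (fun e => hcomp e x); split.
- exact: undup_uniq.
- by move=> e; exact: hcompP.
- by rewrite sum_hcomp_mdegs.
Qed.

Lemma ring_uniq (s : seq int) (c : int -> S^o) :
  uniq s -> (forall e, homog_part e (c e)) -> \sum_(e <- s) c e = 0 ->
  forall e, e \in s -> c e = 0.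
Proof. by move=> us hc; apply: (@sum_homog_eq0 0) => // d; rewrite add0r. Qed.

Definition gr_ring : gradedMod :=
  @GradedMod S^o homog_part homog_part0 homog_partB homog_partM
    ring_gen ring_uniq.

Section Free.
Variable a : seq int.
Local Notation F := 'rV[S]_(size a).

Definition free_part (e : int) (v : F) : Prop :=
  forall j : 'I_(size a), homog_part (a`_j + e) (v 0 j).

Lemma free_part0 e : free_part e 0.
Proof. by move=> j; rewrite mxE; exact: homog_part0. Qed.

Lemma free_partB e u v : free_part e u -> free_part e v -> free_part e (u - v).
Proof. by move=> hu hv j; rewrite !mxE; exact: homog_partB. Qed.

Lemma free_partZ d e (p : S) v :
  homog_part d p -> free_part e v -> free_part (d + e) (p *: v).
Proof. by move=> hp hv j; rewrite mxE addrCA; exact: homog_partM. Qed.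

Lemma free_gen (x : F) : exists (s : seq int) (c : int -> F),
  [/\ uniq s, forall e, free_part e (c e) & x = \sum_(e <- s) c e].
Proof.
exists (undup [seq (mdeg m)%:Z - a`_j | j : 'I_(size a) <- enum 'I_(size a),
                  m : 'X_{1..n} <- msupp (x 0 j)]).
exists (fun e => \row_j hcomp (a`_j + e) (x 0 j)); split.
- exact: undup_uniq.
- by move=> e j; rewrite mxE; exact: hcompP.
apply/rowP => j; rewrite summxE; under eq_bigr do rewrite mxE.
rewrite sum_hcomp ?undup_uniq // => m ms; rewrite mem_undup.
by apply/allpairsPdep; exists j, m; rewrite mem_enum.
Qed.

Lemma free_uniq (s : seq int) (c : int -> F) :
  uniq s -> (forall e, free_part e (c e)) -> \sum_(e <- s) c e = 0 ->
  forall e, e \in s -> c e = 0.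
Proof.
move=> us hc s0 e es; apply/rowP => j; rewrite [RHS]mxE.
apply: (@sum_homog_eq0 a`_j s (fun d => c d 0 j)) => //.
  by move=> d; exact: hc.
by rewrite -summxE s0 mxE.
Qed.

(* The direct sum of the S(a`_j): the j-th coordinate of an element of degree e
   lies in S(a`_j)_e = S_(a`_j + e). *)
Definition gr_free : gradedMod :=
  @GradedMod F free_part free_part0 free_partB free_partZ free_gen free_uniq.

End Free.

Section Quotient.
Variable G : S -> Prop.

(* The ideal generated by the elements of G. *)
Definition ideal_gen : {pred S} := fun p =>
  `[< exists s : seq (S * S),
        (forall x, x \in s -> G x.2) /\ p = \sum_(x <- s) x.1 * x.2 >].

Lemma ideal_gen_zmod_closed : zmod_closed ideal_gen.
Proof.
split; first by apply/asboolP; exists [::]; rewrite big_nil.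
move=> p q /asboolP[s [hs ->]] /asboolP[t [ht ->]]; apply/asboolP.
exists (s ++ [seq (- x.1, x.2) | x <- t]); split.
  by move=> x; rewrite mem_cat => /orP[/hs //|/mapP[y /ht hy ->]].
rewrite big_cat big_map -sumrN /=; congr (_ + _).
by apply: eq_bigr => x _; rewrite mulNr.
Qed.

HB.instance Definition _ :=
  GRing.isZmodClosed.Build S ideal_gen ideal_gen_zmod_closed.

Lemma ideal_genMl p q : q \in ideal_gen -> p * q \in ideal_gen.
Proof.
move=> /asboolP[s [hs ->]]; apply/asboolP.
exists [seq (p * x.1, x.2) | x <- s]; split.
  by move=> x /mapP[y /hs hy ->].
by rewrite big_map mulr_sumr; apply: eq_bigr => x _; rewrite mulrA.
Qed.

Definition quot_gen : Type := {ideal_quot ideal_gen}.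
HB.instance Definition _ := GRing.Zmodule.on quot_gen.

Definition quot_proj (p : S^o) : quot_gen := \pi_{ideal_quot ideal_gen} p.

Definition quot_scale (p : S) (x : quot_gen) : quot_gen :=
  quot_proj (p * repr (x : {ideal_quot ideal_gen})).

Lemma quot_proj_eq p q : quot_proj p = quot_proj q <-> p - q \in ideal_gen.
Proof. by rewrite (rwP eqP) /quot_proj -Quotient.idealrBE. Qed.

Lemma quot_projK (x : quot_gen) : quot_proj (repr (x : {ideal_quot ideal_gen})) = x.
Proof. exact: reprK. Qed.

Lemma quot_projD p q : quot_proj (p + q) = quot_proj p + quot_proj q.
Proof. exact: (raddfD (\pi_{ideal_quot ideal_gen})). Qed.

Lemma quot_scaleE p q : quot_scale p (quot_proj q) = quot_proj (p * q).
Proof.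
by apply/quot_proj_eq; rewrite -mulrBr ideal_genMl //; apply/quot_proj_eq/reprK.
Qed.

Lemma quot_scaleA p q x : quot_scale p (quot_scale q x) = quot_scale (p * q) x.
Proof. by rewrite -[x]quot_projK !quot_scaleE mulrA. Qed.

Lemma quot_scale1 : left_id 1 quot_scale.
Proof. by move=> x; rewrite -[x]quot_projK quot_scaleE mul1r. Qed.

Lemma quot_scaleDr : right_distributive quot_scale +%R.
Proof.
move=> p x y; rewrite -[x]quot_projK -[y]quot_projK -quot_projD !quot_scaleE.
by rewrite mulrDr quot_projD.
Qed.

Lemma quot_scaleDl x : {morph quot_scale^~ x : p q / p + q}.
Proof. by move=> p q; rewrite -[x]quot_projK !quot_scaleE mulrDl quot_projD. Qed.

HB.instance Definition _ := GRing.Zmodule_isLmodule.Build S quot_gen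
  quot_scaleA quot_scale1 quot_scaleDr quot_scaleDl.

Lemma quot_proj_linear : linear quot_proj.
Proof. by move=> p q r; rewrite quot_projD -[p *: q]/(p * q) -quot_scaleE. Qed.

HB.instance Definition _ :=
  GRing.isLinear.Build S S^o quot_gen _ quot_proj quot_proj_linear.

Hypothesis homG : forall p, G p -> exists d, p \is d.-homog.

Lemma ideal_gen_hcomp e p : p \in ideal_gen -> hcomp e p \in ideal_gen.
Proof.
move=> /asboolP[s [hs ->]]; rewrite hcomp_sum big_seq rpred_sum // => x xs.
have [d hd] := homG (hs x xs).
rewrite -[x.1]sum_hcomp_mdegs mulr_suml hcomp_sum rpred_sum // => c _.
have hcd : homog_part (c + d%:Z) (hcomp c x.1 * x.2).
  exact: (@homog_partM c d%:Z) (hcompP c x.1) hd.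
have [->|ne] := eqVneq e (c + d%:Z); last by rewrite (hcomp_eq0 hcd ne) rpred0.
rewrite (hcomp_id hcd) ideal_genMl //; apply/asboolP.
exists [:: (1, x.2)]; rewrite big_seq1 mul1r; split=> // y.
by rewrite inE => /eqP ->; exact: hs x xs.
Qed.

Definition quot_part (e : int) (x : quot_gen) : Prop :=
  exists2 p, homog_part e p & x = quot_proj p.

Lemma quot_part0 e : quot_part e 0.
Proof. by exists 0; rewrite ?raddf0 //; exact: homog_part0. Qed.

Lemma quot_partB e x y : quot_part e x -> quot_part e y -> quot_part e (x - y).
Proof.
move=> [p hp ->] [q hq ->]; exists (p - q); first exact: homog_partB.
by rewrite raddfB.
Qed.

Lemma quot_partZ d e (p : S) x :
  homog_part d p -> quot_part e x -> quot_part (d + e) (p *: x).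
Proof.
move=> hp [q hq ->]; exists (p * q); first exact: homog_partM.
exact: quot_scaleE.
Qed.

Lemma quot_part_gen x : exists (s : seq int) (c : int -> quot_gen),
  [/\ uniq s, forall e, quot_part e (c e) & x = \sum_(e <- s) c e].
Proof.
have [s [c [us hc E]]] := ring_gen (repr (x : {ideal_quot ideal_gen})).
exists s, (fun e => quot_proj (c e)); split=> //; first by move=> e; exists (c e).
by rewrite -[LHS]quot_projK E raddf_sum.
Qed.

Lemma quot_part_uniq (s : seq int) (c : int -> quot_gen) :
  uniq s -> (forall e, quot_part e (c e)) -> \sum_(e <- s) c e = 0 ->
  forall e, e \in s -> c e = 0.
Proof.
move=> us hc s0 e es.
have /choice[q hq] : forall e, exists p, homog_part e p /\ c e = quot_proj p.
  by move=> d; have [p] := hc d; exists p.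
have : \sum_(d <- s) q d \in ideal_gen.
  rewrite -[X in X \in _]subr0; apply/quot_proj_eq.
  rewrite raddf0 -[RHS]s0 raddf_sum; apply: eq_bigr => d _.
  by rewrite (hq d).2.
move/(ideal_gen_hcomp e); rewrite hcomp_sum (bigD1_seq e) //=.
rewrite (hcomp_id (hq e).1) big1 ?addr0 => [he|d ne]; last first.
  by rewrite (hcomp_eq0 (hq d).1) // eq_sym.
rewrite (hq e).2 -(raddf0 quot_proj); apply/quot_proj_eq.
by rewrite subr0.
Qed.

Definition gr_quot : gradedMod :=
  @GradedMod quot_gen quot_part quot_part0 quot_partB quot_partZ
    quot_part_gen quot_part_uniq.

End Quotient.

Definition irreducible_mpoly (f : S) : Prop :=
  [/\ f != 0, f \isn't a GRing.unit
    & forall g h : S, f = g * h -> g \is a GRing.unit \/ h \is a GRing.unit].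

End Graded.

Section Veronese.
Variable k : fieldType.

(* The coordinates of P^5 are taken in the order
   x_00, x_01, x_02, x_11, x_12, x_22. *)
Definition veronese (a : 'I_3 -> k) : 'I_6 -> k :=
  let a0 := a (inord 0) in let a1 := a (inord 1) in let a2 := a (inord 2) in
  tnth [tuple a0 ^+ 2; a0 * a1; a0 * a2; a1 ^+ 2; a1 * a2; a2 ^+ 2].

Variable f : {mpoly k[3]}.

(* Points of projective spaces are given by nonzero coordinate vectors;
   [b] ranges over all homogeneous coordinates of the points of sigma(C). *)
Definition veronese_curve (b : 'I_6 -> k) : Prop :=
  exists a c, [/\ exists i, a i != 0, f.@[a] = 0, c != 0
    & forall i, b i = c * veronese a i].

Definition vanishing_homog (g : {mpoly k[6]}) : Prop :=
  (exists d, g \is d.-homog) /\ (forall b, veronese_curve b -> g.@[b] = 0).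

Lemma vanishing_homogW g : vanishing_homog g -> exists d, g \is d.-homog.
Proof. by case. Qed.

(* S / I_C, where I_C is [ideal_gen vanishing_homog]. *)
Definition curve_ring : gradedMod k 6 := gr_quot vanishing_homogW.

Definition curve_proj : {linear gr_ring k 6 -> curve_ring} :=
  quot_proj vanishing_homog.

End Veronese.

(* Main.v *)
(* Let T = k[x0,x1,x2] and let phi : S -> T be x_ij |-> x_i x_j. By the
   Nullstellensatz for the irreducible f, a form g vanishes on sigma(C) iff f
   divides phi(g). The image of phi is the even part of T, and since deg f is
   odd the cofactor phi(g)/f is odd;
     hence I_C/I_V = f T_odd, where I_V = ker phi
   is the ideal of the Veronese surface and T_odd is the S-module generated by
   x0, x1, x2. The resolution is the mapping cone of a lift of multiplication
   by f from a resolution of T_odd to the resolution of S/I_V.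

   The resolution A of S/I_V has explicit matrices of sizes 6x1, 8x6, 3x8, and
   T_odd, being the canonical module of the Veronese ring, is resolved by the
   transposed complex. x00, x11, x22 is a regular sequence on both modules, so
   exactness may be checked after setting these variables to 0. There A becomes
   the resolution of k[u,v,w]/(u,v,w)^2, and exactness follows from u, v, w
   being a regular sequence. *)

From HB Require Import structures.
Require Import Defs.
From mathcomp Require Import all_boot all_order all_algebra.
From mathcomp Require Import boolp mpoly.
From mathcomp Require Import ring zify.

Set Implicit Arguments.
Unset Strict Implicit.
Unset Printing Implicit Defensive.

Import GRing.Theory.
Local Open Scope ring_scope.

(** * Factoriality of polynomial rings *)

Section Factorial.
Variable R : idomainType.

(** A degree count explains every shift. The map phi doubles degrees, so each f x_i, of degree 2m in
    T, comes from a form of degree m in S; this places the generators of T_odd in S(-m). The steps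
    of A have degrees 2, 1, 1, whence the shifts 2, 3, 4; its transpose has steps 1, 1, 2, whence m,
    m+1, m+2, m+4. The comparison maps then have degrees m, m-1, m-1, m.

    Exactness of the matrix complexes does not say what they resolve. That the first matrices give
    all of ker phi, and all relations among x0, x1, x2 over S, is shown separately by monomial
    normal forms.

    The points of sigma(C) come from nonzero vectors only, while the affine Nullstellensatz needs
    vanishing at 0 too; it is therefore applied to x0 phi(g). For a single irreducible f it is
    proved by induction on the number of variables, from Gauss's lemma and a Bezout identity in the
    last variable, which is why factoriality comes up at all. *)

Definition divides (a b : R) := exists c, b = c * a.

Definition irreducible (p : R) : Prop :=
  [/\ p != 0, p \isn't a GRing.unit
    & forall g h : R, p = g * h -> g \is a GRing.unit \/ h \is a GRing.unit].

(* The additive length [mu] counts irreducible factors; it replaces the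
   existence of factorizations in the definition of a factorial domain. *)
Definition factorial : Prop := exists mu : R -> nat,
  [/\ forall a b, a != 0 -> b != 0 -> mu (a * b) = (mu a + mu b)%N,
      forall a, a != 0 -> (mu a == 0%N) = (a \is a GRing.unit)
    & forall p, irreducible p -> forall a b,
        divides p (a * b) -> divides p a \/ divides p b].

(** Induction on [mu]: splitting a nonunit into two nonunits strictly lowers [mu], so an irreducible
    factor exists, and removing it lowers [mu] again. *)
Lemma factorial_ind (P : R -> Prop) : factorial ->
  (forall a, a \is a GRing.unit -> P a) ->
  (forall p a, irreducible p -> a != 0 -> P a -> P (p * a)) ->
  forall a, a != 0 -> P a.
Proof.
move=> [mu [muM mu0 _]] Pu Pp.
have ex_irr n a : (mu a <= n)%N -> a != 0 -> a \isn't a GRing.unit ->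
    exists p b, irreducible p /\ a = p * b.
  elim: n a => [|n IHn] a; first by rewrite leqn0 => + a0; rewrite mu0 // => ->.
  move=> an a0 au.
  have [[g [h [ag gu hu]]]|nex] := pselect (exists g h,
      [/\ a = g * h, g \isn't a GRing.unit & h \isn't a GRing.unit]).
    have /norP[g0 h0] : ~~ ((g == 0) || (h == 0)) by rewrite -mulf_eq0 -ag.
    have [|p [b [ip gp]]] := IHn g _ g0 gu.
      have := mu0 h h0; rewrite (negPf hu) => /negbT; rewrite -lt0n => h1.
      by rewrite -ltnS (leq_trans _ an) // ag muM // -addn1 leq_add2l.
    by exists p, (b * h); rewrite mulrA -gp.
  exists a, 1; split; last by rewrite mulr1.
  split=> // g h ag; have [|gu] := boolP (g \is a GRing.unit); first by left.
  have [|hu] := boolP (h \is a GRing.unit); first by right.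
  by case: nex; exists g, h.
move=> a; have [n] := ubnP (mu a); elim: n a => // n IHn a an a0.
have [/Pu //|au] := boolP (a \is a GRing.unit).
have [p [b [ip ab]]] := ex_irr _ a (leqnn _) a0 au.
have b0 : b != 0 by apply: contraNneq a0 => b0; rewrite ab b0 mulr0.
rewrite ab; apply: Pp => //; apply: IHn => //.
have [p0 pu _] := ip; have := mu0 p p0; rewrite (negPf pu) => /negbT.
rewrite -lt0n => p1; rewrite -ltnS (leq_trans _ an) // ltnS ab muM //.
by rewrite -add1n leq_add2r.
Qed.

Lemma irreducible_prime p a b : factorial -> irreducible p ->
  divides p (a * b) -> divides p a \/ divides p b.
Proof. by move=> [mu [_ _ primeR]] /primeR; apply. Qed.

(** Gauss's lemma by removing leading terms: [p] divides the product of the leading coefficients,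
    hence one of them, and dropping that leading term keeps the product divisible by [p]. *)
Lemma Gauss_prime p (F G H : {poly R}) : factorial -> irreducible p ->
  F * G = p *: H -> (exists F', F = p *: F') \/ (exists G', G = p *: G').
Proof.
move=> fR ip; have [n] := ubnP (size F + size G).
elim: n F G H => // n IHn F G H FGn FG.
have [->|F0] := eqVneq F 0; first by left; exists 0; rewrite scaler0.
have [->|G0] := eqVneq G 0; first by right; exists 0; rewrite scaler0.
pose tl (A : {poly R}) := A - lead_coef A *: 'X^((size A).-1).
have tls A : A != 0 -> (size (tl A) < size A)%N.
  move=> A0; rewrite [X in (_ < X)%N](polySpred A0) ltnS; apply/leq_sizeP => j.
  rewrite leq_eqVlt => /predU1P[<-|Aj].
    by rewrite coefB coefZ coefXn eqxx mulr1 subrr.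
  rewrite coefB coefZ coefXn gtn_eqF // mulr0 subr0 nth_default //.
  by rewrite (polySpred A0).
have /(irreducible_prime fR ip) : divides p (lead_coef F * lead_coef G).
  by rewrite -lead_coefM FG lead_coefZ; exists (lead_coef H); rewrite mulrC.
case=> [] [c E].
  have [| |[F' E']|] := IHn (tl F) G (H - c *: 'X^((size F).-1) * G);
    last by right.
  - by rewrite -ltnS (leq_trans _ FGn) // ltnS ltn_add2r tls.
  - by rewrite mulrBl FG E scalerBr [c * p]mulrC -scalerA -!scalerAl.
  left; exists (F' + c *: 'X^((size F).-1)).
  by rewrite scalerDr -E' scalerA mulrC -E subrK.
have [| |FE|[G' E']] := IHn F (tl G) (H - F * (c *: 'X^((size G).-1))).
- by rewrite -ltnS (leq_trans _ FGn) // ltnS ltn_add2l tls.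
- by rewrite mulrBr FG E scalerBr [c * p]mulrC -scalerA -!scalerAr.
- by left.
right; exists (G' + c *: 'X^((size G).-1)).
by rewrite scalerDr -E' scalerA mulrC -E subrK.
Qed.

End Factorial.

(** * Gauss's theorem: factoriality passes to polynomials in one variable *)

Section FactorialPoly.
Variable R : idomainType.
Hypothesis fR : factorial R.
Implicit Types (c : R) (F G d q : {poly R}).

Lemma polyZ_inj c : c != 0 -> injective ( *:%R c : {poly R} -> {poly R}).
Proof.
by move=> c0 F G; rewrite -!mul_polyC; apply: mulfI; rewrite polyC_eq0.
Qed.

(** The irreducible factors of [c] are cancelled one by one: each divides [q], since dividing the
    nonconstant irreducible [F] would split [F]. *)
Lemma irreducible_poly_cancel c F G q : irreducible F -> (1 < size F)%N ->
  c != 0 -> c *: G = q * F -> divides F G.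
Proof.
move=> [F0 Fu Fi] F1 c0; move: c c0 q.
apply: (factorial_ind fR) => [c cu q E|p c ip c0 IH q].
  by exists (c^-1 *: q); rewrite -scalerAl -E scalerA mulVr // scale1r.
have [p0 pu _] := ip; rewrite -scalerA => /esym E.
have pI := polyZ_inj p0.
have [[q' q'E]|[F' F'E]] := Gauss_prime fR ip E.
  by apply: (IH q'); apply: pI; rewrite -E q'E scalerAl.
have [] : p%:P \is a GRing.unit \/ F' \is a GRing.unit.
- by apply: Fi; rewrite mul_polyC.
- by rewrite poly_unitE coefC /= (negPf pu) andbF.
- by rewrite poly_unitE => /andP[/eqP F'1 _];
    rewrite F'E size_scale // F'1 in F1.
Qed.

(** Each irreducible factor of [c] is cancelled against [q] or [d]; those taken out of [d] are
    collected in [e]. *)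
Lemma factor_scaled c F d q : c != 0 -> c *: F = q * d ->
  exists d' q' e, F = q' * d' /\ d = e *: d'.
Proof.
move=> c0; move: c c0 d q.
apply: (factorial_ind fR) => [c cu d q E|p c ip c0 IH d q].
  exists d, (c^-1 *: q), 1; rewrite scale1r; split=> //.
  by rewrite -scalerAl -E scalerA mulVr // scale1r.
have [p0 pu _] := ip; rewrite -scalerA => /esym E.
have pI := polyZ_inj p0.
have [[q1 q1E]|[d1 d1E]] := Gauss_prime fR ip E.
  by apply: (IH d q1); apply: pI; rewrite -E q1E scalerAl.
have [|d' [q' [e [FE d1E']]]] := IH d1 q.
  by apply: pI; rewrite -E d1E scalerAr.
by exists d', q', (p * e); rewrite d1E d1E' scalerA.
Qed.

(** [gcdp] divides [F] and [G] only up to constants of R. A nonconstant gcd becomes, after clearing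
    constants, a true factor of [F], hence an associate of [F], and the constant in front of [G] is
    cancelled. *)
Lemma irreducible_coprimeVdvd F G : irreducible F -> (1 < size F)%N ->
  coprimep F G \/ divides F G.
Proof.
move=> iF F1; have [F0 Fu Fi] := iF; rewrite coprimep_def.
case: eqVneq => [_|d1]; [by left | right].
have /Pdiv.WeakIdomain.dvdpP[[c q] /= c0 E] := dvdp_gcdl F G.
have /Pdiv.WeakIdomain.dvdpP[[c' q'] /= c'0 E'] := dvdp_gcdr F G.
have [d' [r [e [FE dE]]]] := factor_scaled c0 E.
have : r \is a GRing.unit.
  have [//|d'u] := Fi _ _ FE; case/eqP: d1.
  have e0 : e != 0.
    apply: contraNneq F0 => e0; move/eqP: dE; rewrite e0 scale0r gcdp_eq0.
    by case/andP.
  by move: d'u; rewrite dE size_scale // poly_unitE => /andP[/eqP].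
move=> ru; apply: (@irreducible_poly_cancel c' F G (q' * (e *: r^-1))) => //.
by rewrite E' dE FE -mulrA -!scalerAl mulrA mulVr // mul1r.
Qed.

Lemma irreducible_polyC c : irreducible c%:P -> irreducible c.
Proof.
move=> [c0 cu ci]; split; first by rewrite -polyC_eq0.
  by apply: contraNN cu => cu; rewrite rmorph_unit.
move=> g h cE; have [] := ci g%:P h%:P; rewrite ?cE ?polyCM //.
  by rewrite poly_unitE coefC => /andP[_]; left.
by rewrite poly_unitE coefC => /andP[_]; right.
Qed.

Lemma irreducible_poly_prime F G H : irreducible F ->
  divides F (G * H) -> divides F G \/ divides F H.
Proof.
move=> iF [Q E]; have [F0 Fu Fi] := iF.
have [F1|F1] := leqP (size F) 1.
  have [c FE] : exists c, F = c%:P by exists F`_0; exact: size1_polyC.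
  have ic : irreducible c by apply: irreducible_polyC; rewrite -FE.
  have [|[A AE]|[A AE]] := @Gauss_prime _ c G H Q fR ic.
  - by rewrite E FE mulrC mul_polyC.
  - by left; exists A; rewrite AE FE mulrC mul_polyC.
  - by right; exists A; rewrite AE FE mulrC mul_polyC.
have [|] := irreducible_coprimeVdvd G iF F1; last by left.
move/Bezout_coprimepP=> [[u v] /=];
  rewrite -size_poly_eq1 => /size_poly1P[c c0 EB].
(* The Bezout identity u F + v G = c multiplied by [H], with G H = Q F. *)
right; apply: (@irreducible_poly_cancel c F H (u * H + v * Q)) => //.
by rewrite -mul_polyC -EB !mulrDl -(mulrA v G H) E mulrA (mulrAC u F H).
Qed.

Lemma factorial_poly : factorial {poly R}.
Proof.
have [mu [muM mu0 _]] := fR.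
(* The degree only bounds the number of nonconstant factors, but additivity and vanishing exactly at
   units are all that is asked of a length. *)
exists (fun F => (size F).-1 + mu (lead_coef F))%N; split.
- move=> F G F0 G0; rewrite size_mul // lead_coefM muM ?lead_coef_eq0 //.
  by rewrite (polySpred F0) (polySpred G0) /= addnS addnACA.
- move=> F F0; rewrite addn_eq0 mu0 ?lead_coef_eq0 // poly_unitE.
  rewrite (polySpred F0) eqSS /lead_coef (polySpred F0) /=.
  by case: eqP => [->|].
- by move=> F iF G H; exact: irreducible_poly_prime.
Qed.

End FactorialPoly.

Section Isomorphism.
Variables (R R' : idomainType) (s : {rmorphism R -> R'}) (t : R' -> R).
Hypotheses (sK : cancel s t) (tK : cancel t s).

Lemma iso_unit a : (s a \is a GRing.unit) = (a \is a GRing.unit).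
Proof.
apply/idP/idP => [/unitrP[b [ba ab]]|]; last exact: rmorph_unit.
by apply/unitrP; exists (t b); split; apply: (can_inj sK);
  rewrite rmorphM tK rmorph1.
Qed.

Lemma iso_divides a b : divides (s a) (s b) -> divides a b.
Proof. by case=> c E; exists (t c); apply: (can_inj sK);
  rewrite rmorphM tK. Qed.

Lemma iso_irreducible p : irreducible p -> irreducible (s p).
Proof.
move=> [p0 pu pi]; split; rewrite ?iso_unit //.
  by rewrite -(rmorph0 s) (can_eq sK).
move=> g h E; rewrite -[g]tK -[h]tK !iso_unit; apply: pi.
by apply: (can_inj sK); rewrite rmorphM !tK.
Qed.

Lemma factorial_iso : factorial R' -> factorial R.
Proof.
move=> [mu [muM mu0 primeR']].
have s0 a : (s a == 0) = (a == 0) by rewrite -(rmorph0 s) (can_eq sK).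
exists (mu \o s); split=> /= [a b a0 b0|a a0|p /iso_irreducible ip a b [c E]].
- by rewrite rmorphM muM ?s0.
- by rewrite mu0 ?s0 // iso_unit.
have [|/iso_divides|/iso_divides] := primeR' _ ip (s a) (s b);
  [|by left|by right].
by exists (s c); rewrite -rmorphM E rmorphM.
Qed.

End Isomorphism.

(** * Polynomials in n+1 variables as polynomials in the last one *)

Section Muni.
Variables (n : nat) (R : idomainType).
Local Notation widen := (widen_ord (leqnSn n)).

Lemma mnm_rconsE (m' : 'X_{1..n.+1}) (m : 'X_{1..n}) j :
  (m' == [multinom of rcons m j]) =
  ([multinom m' (widen i) | i < n] == m) && (m' ord_max == j).
Proof.
apply/eqP/andP => [->|[/eqP <- /eqP <-]].
  split; last first.
    by rewrite multinomE (tnth_nth 0%N) /= nth_rcons size_tuple ltnn eqxx.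
  apply/eqP/mnmP => i; rewrite mnmE multinomE (tnth_nth 0%N) /=.
  by rewrite nth_rcons size_tuple ltn_ord (mnm_nth 0%N).
apply/mnmP => i; rewrite multinomE (tnth_nth 0%N) /= nth_rcons size_tuple.
rewrite card_ord; have [lt_in|ge_in] := ltnP i n; last first.
  have -> : i = ord_max.
    by apply/val_inj/eqP; rewrite eqn_leq ge_in -ltnS ltn_ord.
  by rewrite /= eqxx.
rewrite (nth_map (Ordinal lt_in)) ?size_enum_ord //.
by congr (m' _); apply: val_inj; rewrite /= nth_enum_ord.
Qed.

Lemma mcoeff_muni (p : {mpoly R[n.+1]}) j m :
  (muni p)`_j@_m = p@_([multinom of rcons m j]).
Proof.
rewrite muniE coef_sum raddf_sum /=.
rewrite [p in RHS]mpolyE raddf_sum /=; apply: eq_bigr => m' _.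
rewrite coefZ coefXn mulr_natr mcoeffMn !mcoeffZ !mcoeffX mnm_rconsE -mulrnAr.
by rewrite (eq_sym j); congr (_ * _); case: eqP; case: eqP.
Qed.

Lemma muni_mwiden p : muni (mwiden p) = p%:P :> {poly {mpoly R[n]}}.
Proof.
rewrite [p]mpolyE (raddf_sum (@mwiden n R)) (raddf_sum (@muni n R)).
rewrite (raddf_sum (@polyC _)); apply: eq_bigr => m _.
rewrite /= mwidenZ mwidenX muniZ -mul_mpolyC polyCM -mul_polyC; congr (_ * _).
apply/polyP => j; apply/mpolyP => m'; rewrite mcoeff_muni coefC mcoeffX.
have -> : (mnmwiden m == [multinom of rcons m' j]) = (j == 0%N) && (m == m').
  apply/eqP/andP => [/(congr1 val)/(congr1 val)/= /rcons_inj [mm' <-]|[/eqP->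
    /eqP->]] //.
  by split=> //; apply/eqP; do 2!apply: val_inj.
by case: eqP; rewrite ?mcoeffX ?mcoeff0.
Qed.

Lemma muni_X : muni 'X_ord_max = 'X :> {poly {mpoly R[n]}}.
Proof.
rewrite /muni mmapX mmap1U; case: splitP => //= j /= E.
by have := ltn_ord j; rewrite -E ltnn.
Qed.

Definition mjoin (q : {poly {mpoly R[n]}}) : {mpoly R[n.+1]} :=
  (map_poly (@mwiden n R) q).['X_ord_max].

Lemma mjoinK : cancel mjoin (@muni n R).
Proof.
rewrite /mjoin; elim/poly_ind => [|q c IHq].
  by rewrite rmorph0 horner0 muni0.
rewrite rmorphD rmorphM /= map_polyX map_polyC hornerMXaddC.
by rewrite muniD muniM muni_X IHq; congr (_ + _); exact: muni_mwiden.
Qed.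

Lemma muni_inj : injective (@muni n R).
Proof.
move=> p q pq; apply/mpolyP => m.
have -> : m = [multinom of rcons [multinom m (widen i) | i < n] (m ord_max)].
  by apply/eqP; rewrite mnm_rconsE !eqxx.
by rewrite -!mcoeff_muni pq.
Qed.

Lemma muniK : cancel (@muni n R) mjoin.
Proof. exact: inj_can_sym mjoinK muni_inj. Qed.

Lemma meval_muni (v : 'I_n.+1 -> R) (p : {mpoly R[n.+1]}) :
  p.@[v] = (map_poly (meval (v \o widen)) (muni p)).[v ord_max].
Proof.
rewrite muniE mevalE rmorph_sum horner_sum; apply: eq_bigr => m _ /=.
rewrite map_polyZ map_polyXn hornerZ hornerXn /= mevalZ mevalX big_ord_recr /=
  mulrA.
by congr (_ * _ * _); apply: eq_bigr => i _; rewrite mnmE.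
Qed.

Definition vjoin (v : 'I_n -> R) (x : R) (i : 'I_n.+1) : R :=
  if unlift ord_max i is Some j then v j else x.

Lemma meval_vjoin (v : 'I_n -> R) (x : R) (p : {mpoly R[n.+1]}) :
  p.@[vjoin v x] = (map_poly (meval v) (muni p)).[x].
Proof.
rewrite meval_muni {2}/vjoin unlift_none; congr _.[_].
apply: eq_map_poly => q; apply: meval_eq => i; rewrite /vjoin /=.
have -> : widen i = lift ord_max i by apply: val_inj;
  rewrite /= /bump leqNgt ltn_ord.
by rewrite liftK.
Qed.

End Muni.

Lemma mpoly0_unit (k : fieldType) (a : {mpoly k[0]}) :
  a != 0 -> a \is a GRing.unit.
Proof.
have -> : a = (a@_0)%:MP.
  apply/mpolyP => m; have -> : m = 0%MM by apply/mnmP; case.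
  by rewrite mcoeffC eqxx mulr1.
by rewrite mpolyC_eq0 => a0; rewrite rmorph_unit ?unitfE.
Qed.

Lemma factorial_mpoly (k : fieldType) n : factorial {mpoly k[n]}.
Proof.
elim: n => [|n IHn].
  by exists (fun=> 0%N); split=> // [a /mpoly0_unit ->|p [/mpoly0_unit->]].
exact: (factorial_iso (@muniK n k) (@mjoinK n k) (factorial_poly IHn)).
Qed.

Lemma common_root_Bezout (R K : comNzRingType) (s : {rmorphism R -> K})
    (u v F G : {poly R}) c x :
  u * F + v * G = c%:P -> (map_poly s F).[x] = 0 -> (map_poly s G).[x] = 0 ->
  s c = 0.
Proof.
move=> E Fx Gx; rewrite -(hornerC (s c) x) -map_polyC -E rmorphD !rmorphM.
by rewrite hornerD !hornerM Fx Gx !mulr0 addr0.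
Qed.

(** * The Nullstellensatz for an irreducible hypersurface *)

Section Nullstellensatz.
Variable k : closedFieldType.

(** A root x of the nonconstant polynomial p X + 1 satisfies x p(x) = -1. *)
Lemma nonroot_exists (p : {poly k}) : p != 0 -> exists x, p.[x] != 0.
Proof.
move=> p0; have /closed_rootP[x] : size (p * 'X + 1%:P) != 1%N.
  by rewrite size_MXaddC (negPf p0) eqSS size_poly_eq0.
rewrite rootE hornerMXaddC => /eqP E; exists x; apply: contra_eq_neq E => ->.
by rewrite mul0r add0r oner_eq0.
Qed.

Lemma nonzero_meval n (p : {mpoly k[n]}) : p != 0 -> exists v, p.@[v] != 0.
Proof.
elim: n p => [|n IHn] p p0.
  exists (fun=> 0); apply: contraNneq p0 => E; apply/eqP/mpolyP => m.
  rewrite mcoeff0 -E mevalE; have m0 (m' : 'X_{1..0}) : m' = m.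
    by apply/mnmP; case.
  have [ms|ms] := boolP (m \in msupp p).
    rewrite (bigD1_seq m) //= big_ord0 mulr1 big1 ?addr0 // => m'.
    by rewrite (m0 m') eqxx.
  by rewrite big1_seq ?memN_msupp_eq0 // => m'; rewrite (m0 m') (negPf ms).
have mp0 : muni p != 0 by rewrite -(muni0 n k) (inj_eq (@muni_inj n k)).
have [v lv] : exists v, (lead_coef (muni p)).@[v] != 0 by apply: IHn;
  rewrite lead_coef_eq0.
have [|x px] := @nonroot_exists (map_poly (meval v) (muni p)).
  apply: contraNneq lv => E; rewrite /lead_coef -[_.@[v]](coef_map (meval v)) E.
  by rewrite coef0.
by exists (vjoin v x); rewrite meval_vjoin.
Qed.

Lemma Nullstellensatz_irreducible n (f g : {mpoly k[n]}) : irreducible f ->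
  (forall v, f.@[v] = 0 -> g.@[v] = 0) -> divides f g.
Proof.
elim: n f g => [|n IHn] f g irr_f f0g0.
  by case: irr_f => /mpoly0_unit ->.
have irr_F : irreducible (muni f).
  exact: (iso_irreducible (@muniK n k) (@mjoinK n k) irr_f).
apply: (iso_divides (@muniK n k) (@mjoinK n k)).
have [f1|f1] := leqP (size (muni f)) 1; last first.
  have [|//] := irreducible_coprimeVdvd (factorial_mpoly k n) (muni g) irr_F f1.
  move/Bezout_coprimepP=> [[u v] /=].
  rewrite -size_poly_eq1 => /size_poly1P[c c0 E].
  have [F0 _ _] := irr_F.
  (* The leading coefficient must survive at [w] for f(w, _) to keep its positive degree and have a
     root; a common root of f and g then contradicts c(w) != 0. *)
  have [w] : exists w, (c * lead_coef (muni f)).@[w] != 0.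
    by apply: nonzero_meval; rewrite mulf_neq0 ?lead_coef_eq0.
  rewrite mevalM mulf_eq0 => /norP[cw lw].
  have /closed_rootP[x] : size (map_poly (meval w) (muni f)) != 1%N.
    by rewrite size_map_poly_id0 // gtn_eqF.
  rewrite rootE -meval_vjoin => /eqP fx; have := f0g0 _ fx; rewrite meval_vjoin.
  move=> gx; rewrite meval_vjoin in fx; case/eqP: cw.
  exact: (common_root_Bezout E fx gx).
have [c fE] : exists c, muni f = c%:P by exists (muni f)`_0; exact: size1_polyC.
have irr_c : irreducible c by apply: irreducible_polyC; rewrite -fE.
(* Here [f] does not involve the last variable: above a zero of [c], [g] vanishes on a whole line,
   so all its coefficients in the last variable vanish there. *)
have /choice[d dE] j : divides c (muni g)`_j.
  apply: IHn => // v cv;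
  suff -> : ((muni g)`_j).@[v] = (map_poly (meval v) (muni g))`_j.
    have [->|/nonroot_exists[x]] := eqVneq (map_poly (meval v) (muni g)) 0;
      first by rewrite coef0.
    by rewrite -meval_vjoin f0g0 ?eqxx // meval_vjoin fE map_polyC hornerC.
  by rewrite coef_map.
exists (\poly_(j < size (muni g)) d j); apply/polyP => j.
rewrite /= fE coefMC coef_poly; case: ltnP => [_|/leq_sizeP->//];
  first exact: dE.
by rewrite mul0r.
Qed.

End Nullstellensatz.

(** * The matrices of the resolution *)

Section ListMatrices.
Variable R : comNzRingType.
Implicit Types (s t : seq R) (rs : seq (seq R)).

(** Storing concrete matrices as lists makes their products reduce by computation to explicit
    expressions that [ring] can compare. *)
Definition rowseq n s : 'rV[R]_n := \row_j s`_j.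

Definition mxseq m n rs : 'M[R]_(m, n) := \matrix_(i, j) (nth [::] rs i)`_j.

Fixpoint dot s t : R :=
  match s, t with
  | x :: s', y :: t' => x * y + dot s' t'
  | _, _ => 0
  end.

Lemma dotE n s t : size s = n -> \sum_(i < n) s`_i * t`_i = dot s t.
Proof.
elim: s t n => [|x s IHs] [|y t] [|n] //= => [_|_|[sn]|[sn]];
  rewrite ?big_ord0 //.
  by rewrite big1 // => i _; rewrite nth_nil mulr0.
by rewrite big_ord_recl (IHs t).
Qed.

Lemma mul_rowseq m n s rs : size s = m -> size rs = m ->
  rowseq m s *m mxseq m n rs =
  rowseq n [seq dot s [seq r`_j | r <- rs] | j <- iota 0 n].
Proof.
move=> sm rsm; apply/rowP => j; rewrite !mxE (nth_map 0%N) ?size_iota //.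
rewrite nth_iota // -(dotE _ sm); apply: eq_bigr => i _.
by rewrite !mxE (nth_map [::]) // rsm.
Qed.

Lemma mul_rowseq_tr m n s rs : size s = n -> size rs = m ->
  rowseq n s *m (mxseq m n rs)^T = rowseq m [seq dot s r | r <- rs].
Proof.
move=> sn rsm; apply/rowP => j; rewrite !mxE (nth_map [::]) ?rsm //.
by rewrite -(dotE _ sn); apply: eq_bigr => i _; rewrite !mxE.
Qed.

Lemma mul_mxseq m n p rs rt :
    size rs = m -> all (fun r => size r == n) rs -> size rt = n ->
  mxseq m n rs *m mxseq n p rt =
  mxseq m p [seq [seq dot r [seq t`_j | t <- rt] | j <- iota 0 p] | r <- rs].
Proof.
move=> rsm rsn rtn; apply/matrixP => i j; rewrite !mxE (nth_map [::]) ?rsm //.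
rewrite (nth_map 0%N) ?size_iota // nth_iota //.
rewrite -(@dotE n); last by apply/eqP/(allP rsn)/mem_nth; rewrite rsm.
by apply: eq_bigr => l _; rewrite !mxE (nth_map [::]) // rtn.
Qed.

Lemma rowseq_eq0 n s : rowseq n s = 0 -> size s = n -> s = nseq n 0.
Proof.
move=> s0 sn; apply: (@eq_from_nth _ 0); first by rewrite size_nseq.
move=> i; rewrite sn => ilt; rewrite nth_nseq ilt.
by have /rowP/(_ (Ordinal ilt)) := s0; rewrite !mxE.
Qed.

Lemma rowseqP n (y : 'rV[R]_n) : exists2 s, size s = n & y = rowseq n s.
Proof.
exists [seq y 0 j | j <- enum 'I_n]; first by rewrite size_map size_enum_ord.
apply/rowP => j; rewrite mxE (nth_map j) ?size_enum_ord //.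
by rewrite nth_ord_enum.
Qed.

End ListMatrices.

Lemma map_mxseq (R R' : comNzRingType) (f : {rmorphism R -> R'}) m n rs :
  map_mx f (mxseq m n rs) = mxseq m n [seq [seq f x | x <- r] | r <- rs].
Proof.
apply/matrixP => i j; rewrite !mxE.
have [irs|irs] := ltnP i (size rs); last first.
  by rewrite (nth_default [::] irs) (nth_default [::]) ?size_map // !nth_nil
    rmorph0.
rewrite (nth_map [::]) //.
have [jr|jr] := ltnP j (size (nth [::] rs i)); first by rewrite (nth_map 0).
by rewrite (nth_default _ jr) nth_default ?size_map // rmorph0.
Qed.

(* [vmx1] lists the 2x2 minors of the symmetric matrix
   [[a, w, v], [w, b, u], [v, u, c]]; (a, b, c, u, v, w) will be
   (x00, x11, x22, x12, x02, x01). *)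
Section Veronese_matrices.
Variables (R : comNzRingType) (a b c u v w : R).

Definition vmx1 : 'M[R]_(6, 1) := mxseq 6 1
  [:: [:: u * u - b * c]; [:: u * v - c * w]; [:: u * w - b * v];
      [:: v * v - a * c]; [:: v * w - a * u]; [:: w * w - a * b]].

Definition vmx2 : 'M[R]_(8, 6) := mxseq 8 6
  [:: [:: - v; u; c; 0; 0; 0];
      [:: - w; b; u; 0; 0; 0];
      [:: 0; - w; v; b; 0; - c];
      [:: 0; - v; 0; u; - c; 0];
      [:: a; - w; 0; 0; u; - c];
      [:: 0; a; 0; - w; v; 0];
      [:: 0; 0; - w; 0; - b; u];
      [:: 0; 0; - a; 0; - w; v]].

Definition vmx3 : 'M[R]_(3, 8) := mxseq 3 8
  [:: [:: - w; v; - u; b; 0; 0; - c; 0];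
      [:: a; 0; 0; - w; v; - u; 0; c];
      [:: 0; - a; w; 0; - w; b; v; - u]].

Lemma vmx2_vmx1 : vmx2 *m vmx1 = 0.
Proof.
rewrite mul_mxseq //=; apply/matrixP => i j; rewrite !mxE ord1.
by case: i => [[|[|[|[|[|[|[|[|//]]]]]]]] i8] /=; ring.
Qed.

Lemma vmx3_vmx2 : vmx3 *m vmx2 = 0.
Proof.
rewrite mul_mxseq //=; apply/matrixP => i j; rewrite !mxE.
case: i j => [[|[|[|//]]] i3] [[|[|[|[|[|[|//]]]]]] j6] /=; ring.
Qed.

End Veronese_matrices.

Lemma vmx1_veronese (R : comNzRingType) (x y z : R) :
  vmx1 (x * x) (y * y) (z * z) (y * z) (x * z) (x * y) = 0.
Proof.
apply/matrixP => i j; rewrite !mxE ord1.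
by case: i => [[|[|[|[|[|[|//]]]]]] i6] /=; ring.
Qed.

Lemma vmx3_tr_veronese (R : comNzRingType) (x y z : R) :
  (vmx3 (x * x) (y * y) (z * z) (y * z) (x * z) (x * y))^T *m
    mxseq 3 1 [:: [:: x]; [:: y]; [:: z]] = 0.
Proof.
apply/matrixP => i j; rewrite mxE !big_ord_recl big_ord0 !mxE ord1.
by case: i => [[|[|[|[|[|[|[|[|//]]]]]]]] i8] /=; ring.
Qed.

Lemma map_vmx1 (R R' : comNzRingType) (f : {rmorphism R -> R'}) a b c u v w :
  map_mx f (vmx1 a b c u v w) = vmx1 (f a) (f b) (f c) (f u) (f v) (f w).
Proof. by rewrite map_mxseq /= !rmorphB !rmorphM. Qed.

Lemma map_vmx2 (R R' : comNzRingType) (f : {rmorphism R -> R'}) a b c u v w :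
  map_mx f (vmx2 a b c u v w) = vmx2 (f a) (f b) (f c) (f u) (f v) (f w).
Proof. by rewrite map_mxseq /= !rmorphN !rmorph0. Qed.

Lemma map_vmx3 (R R' : comNzRingType) (f : {rmorphism R -> R'}) a b c u v w :
  map_mx f (vmx3 a b c u v w) = vmx3 (f a) (f b) (f c) (f u) (f v) (f w).
Proof. by rewrite map_mxseq /= !rmorphN !rmorph0. Qed.

Definition in_rows (R : nzRingType) p q (A : 'M[R]_(p, q)) (y : 'rV_q) :=
  exists z, y = z *m A.

Definition exact_mx (R : nzRingType) p q r (A : 'M[R]_(p, q)) (B : 'M_(q, r)) :=
  forall y : 'rV_q, y *m B = 0 -> in_rows A y.

(** * Exactness at a = b = c = 0 *)

Section Degenerate.
Variables (R : idomainType) (u v w : R).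
Hypothesis u0 : u != 0.
Hypothesis reg_v : forall p q, v * p = u * q -> exists r, p = u * r.
Hypothesis reg_w : forall p q r, w * p = u * q + v * r ->
  exists s t, p = u * s + v * t.

(* Turns an equation [e = 0] into [x = y] up to the identity [x - y = e], which
   is left to [ring]. *)
Lemma eq_of_sub (x y e : R) : e = 0 -> x - y = e -> x = y.
Proof. by move=> -> /eqP; rewrite subr_eq0 => /eqP. Qed.

Local Notation d1 := (vmx1 0 0 0 u v w).
Local Notation d2 := (vmx2 0 0 0 u v w).
Local Notation d3 := (vmx3 0 0 0 u v w).

(** Elimination from the last coordinate down: regularity puts y6, then y5, y4, y3, y2 into the
    ideal of the entries that the rows of [d2] allow there, and subtracting these rows clears it.
    The coefficients found are the witness, listed in the order of the rows. *)
Lemma exact_d2_d1 : exact_mx d2 d1.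
Proof.
move=> y; have [[|y1 [|y2 [|y3 [|y4 [|y5 [|y6 [|//]]]]]]] // _ ->] := rowseqP y.
rewrite mul_rowseq //= => /rowseq_eq0/(_ erefl) [E].
have [s1 [t1]] : exists s t, w * y6 = u * s + v * t.
  apply: (reg_w (q := - (y1 * u + y2 * v + y3 * w))
    (r := - (y4 * v + y5 * w))).
  by apply: (eq_of_sub E); ring.
case/reg_w => al [be y6E]; subst y6.
have [g E1] : exists r, y4 * v + (y5 + be * w) * w = u * r.
  apply: (reg_v (q := - (y1 * u + y2 * v + (y3 + al * w) * w))).
  by apply: (eq_of_sub E); ring.
have [ga [de E2]] : exists s t, y5 + be * w = u * s + v * t.
  apply: (reg_w (q := g) (r := - y4)).
  by apply: (eq_of_sub (subrr (u * g))); rewrite -{1}E1; ring.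
have y5E : y5 = u * ga + v * de - be * w by rewrite -E2 addrK.
subst y5.
have [h] : exists r, v * (y4 + de * w) = u * r.
  apply: (reg_v (q := - (y1 * u + (y2 + ga * w) * v + (y3 + al * w) * w))).
  by apply: (eq_of_sub E); ring.
case/reg_v => ep E3.
have y4E : y4 = u * ep - de * w by rewrite -E3 addrK.
subst y4.
have [ze [et E4]] : exists s t, y3 + al * w = u * s + v * t.
  apply: (reg_w (q := - y1) (r := - (y2 + ga * w + ep * v))).
  by apply: (mulfI u0); apply: (eq_of_sub E); ring.
have y3E : y3 = u * ze + v * et - al * w by rewrite -E4 addrK.
subst y3.
have E5 : v * (y2 + ga * w + ep * v + et * w) = u * - (y1 + ze * w).
  by apply: (mulfI u0); apply: (eq_of_sub E); ring.
have [ka E6] := reg_v E5.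
have y2E : y2 = u * ka - et * w - ep * v - ga * w by rewrite -E6; ring.
have y1E : y1 = - v * ka - ze * w.
  have E7 : v * (u * ka) = u * - (y1 + ze * w) by rewrite -E6.
  by apply: (mulfI u0); apply: (eq_of_sub (subrr (v * (u * ka))));
    rewrite {2}E7; ring.
exists (rowseq 8 [:: ka; ze; et; ep; ga; de; al; be]).
rewrite mul_rowseq //= y1E y2E; congr rowseq.
by congr [:: _; _; _; _; _; _]; ring.
Qed.

Lemma koszul_uv p q : v * p = u * q -> exists r, p = u * r /\ q = v * r.
Proof.
move=> E; have [r pE] := reg_v E; exists r; split=> //.
by apply: (mulfI u0); rewrite -E pE; ring.
Qed.

(** Columns 6, 5 and 3 of [d2] are relations between u and v, whose Koszul solutions introduce c3,
    c2, c1; columns 4 and 2 give y4 and y1 after cancelling u. *)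
Lemma exact_d3_d2 : exact_mx d3 d2.
Proof.
move=> y; have [[|y1 [|y2 [|y3 [|y4 [|y5 [|y6 [|y7 [|y8 [|//]]]]]]]]] // _ ->]
  := rowseqP y.
rewrite mul_rowseq //= => /rowseq_eq0/(_ erefl) [E1 E2 E3 E4 E5 E6].
have [c3 [y8E y7N]] : exists r, y8 = u * r /\ - y7 = v * r.
  by apply: koszul_uv; apply: (eq_of_sub E6); ring.
have y7E : y7 = - v * c3 by rewrite mulNr -y7N opprK.
have [c2 [y6E y5N]] : exists r, y6 = u * r /\ - (y5 - w * c3) = v * r.
  by apply: koszul_uv; apply: (eq_of_sub E5); rewrite y8E; ring.
have y5E : y5 = w * c3 - v * c2 by rewrite -y5N; ring.
have y4E : y4 = w * c2.
  by apply: (mulfI u0); apply: (eq_of_sub E4); rewrite y6E; ring.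
have [c1 [y3N y2N]] : exists r, y3 + w * c3 = u * r /\ - y2 = v * r.
  by apply: koszul_uv; apply: (eq_of_sub E3); rewrite y7E; ring.
have y3E : y3 = u * c1 - w * c3 by rewrite -y3N; ring.
have y2E : y2 = - v * c1 by rewrite mulNr -y2N opprK.
have y1E : y1 = w * c1.
  by apply: (mulfI u0); apply: (eq_of_sub E2); rewrite y3E y4E y5E; ring.
exists (rowseq 3 [:: - c1; - c2; - c3]); rewrite mul_rowseq //=.
rewrite y1E y2E y3E y4E y5E y6E y7E y8E; congr rowseq.
by congr [:: _; _; _; _; _; _; _; _]; ring.
Qed.

(** The kernel consists of the multiples of (u^2, uv, uw, v^2, vw, w^2): the factor u in v(vt) = u
    y4 must come from t, and the other coordinates follow by cancelling u. *)
Lemma exact_d1T_d2T : exact_mx d1^T d2^T.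
Proof.
move=> y; have [[|y1 [|y2 [|y3 [|y4 [|y5 [|y6 [|//]]]]]]] // _ ->] := rowseqP y.
rewrite mul_rowseq_tr //= => /rowseq_eq0/(_ erefl) [E1 E2 E3 E4 E5 E6 E7 E8].
have [t [y1E y2E]] : exists r, y1 = u * r /\ y2 = v * r.
  by apply: koszul_uv; apply: (eq_of_sub (oppr0 _)); rewrite -E1; ring.
have y4E : v * (v * t) = u * y4.
  by rewrite -y2E; apply: (eq_of_sub (oppr0 _)); rewrite -E4; ring.
have [t1 [/reg_v[c tE] _]] := koszul_uv y4E; subst t.
exists (rowseq 1 [:: c]); rewrite mul_rowseq_tr //= y1E y2E; congr rowseq.
have -> : y4 = v * (v * c) by apply: (mulfI u0); rewrite -y4E; ring.
have y3E : y3 = u * w * c.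
  by apply: (mulfI u0); apply: (eq_of_sub E2); rewrite y1E; ring.
have y5E : y5 = v * w * c.
  by apply: (mulfI u0); apply: (eq_of_sub E5); rewrite y2E; ring.
have -> : y6 = w * w * c.
  by apply: (mulfI u0); apply: (eq_of_sub E7); rewrite y3E; ring.
by rewrite y3E y5E; congr [:: _; _; _; _; _; _]; ring.
Qed.

(** Relations of a regular sequence of length three are generated by the Koszul ones. *)
Lemma koszul_uvw p q r : - w * p + v * q - u * r = 0 ->
  exists y1 y2 y3,
    [/\ p = u * y2 - v * y1, q = u * y3 - w * y1 & r = v * y3 - w * y2].
Proof.
move=> E; have [y2 [t pE]] : exists s t, p = u * s + v * t.
  apply: (reg_w (q := - r) (r := q)).
  by apply/esym; apply: (eq_of_sub E); ring.
have [y3 [qE rE]] : exists y3, q - w * t = u * y3 /\ r + w * y2 = v * y3.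
  by apply: koszul_uv; apply: (eq_of_sub E); rewrite pE; ring.
exists (- t), y2, y3; rewrite pE -qE -rE.
by split; ring.
Qed.

Lemma exact_d2T_d3T : exact_mx d2^T d3^T.
Proof.
move=> z; have [[|z1 [|z2 [|z3 [|z4 [|z5 [|z6 [|z7 [|z8 [|//]]]]]]]]] // _ ->]
  := rowseqP z.
rewrite mul_rowseq_tr //= => /rowseq_eq0/(_ erefl) [E1 E2 E3].
have [y1 [y2 [y3 [z1E z2E z3E]]]] : exists y1 y2 y3,
    [/\ z1 = u * y2 - v * y1, z2 = u * y3 - w * y1 & z3 = v * y3 - w * y2].
  by apply: koszul_uvw; rewrite -[RHS]E1; ring.
have [x2 [y4 [y5 [z4E z5E z6E]]]] : exists x2 y4 y5,
    [/\ z4 = u * y4 - v * x2, z5 = u * y5 - w * x2 & z6 = v * y5 - w * y4].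
  by apply: koszul_uvw; rewrite -[RHS]E2; ring.
(* The two Koszul solutions must share one parameter, x2 = y2. The third equation puts x2 - y2 in
   (u, v), and each solution is only determined up to multiples of (u, v, w), which absorbs the
   difference. *)
have [s [t]] : exists s t, w * (x2 - y2) = u * s + v * t.
  apply: (reg_w (q := z8 + w * y5) (r := - z7 - w * y3)).
  by apply: (eq_of_sub E3); rewrite z3E z5E; ring.
case/reg_w => al [be x2N].
have x2E : x2 = y2 + u * al + v * be by rewrite -addrA -x2N; ring.
have [y6 [z7N z8N]] : exists y6,
    z7 + w * (y3 + w * be) = u * y6 /\ z8 + w * (y5 - w * al) = v * y6.
  by apply: koszul_uv; apply: (eq_of_sub E3); rewrite z3E z5E x2E; ring.
have z7E : z7 = u * y6 - w * (y3 + w * be) by rewrite -z7N addrK.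
have z8E : z8 = v * y6 - w * (y5 - w * al) by rewrite -z8N addrK.
exists (rowseq 6 [:: y1 + u * be; y2 + v * be; y3 + w * be;
                     y4 - v * al; y5 - w * al; y6]).
rewrite mul_rowseq_tr //= z1E z2E z3E z4E z5E z6E z7E z8E x2E; congr rowseq.
by congr [:: _; _; _; _; _; _; _; _]; ring.
Qed.

End Degenerate.

(** * Injectivity at the left ends of the two complexes *)

Section Injectivity.
Variables (R : idomainType) (a b c u v w : R).

Lemma vmx3_injective : a != 0 -> a * u - v * w != 0 ->
  forall y : 'rV_3, y *m vmx3 a b c u v w = 0 -> y = 0.
Proof.
move=> a0 D0 y; have [[|y1 [|y2 [|y3 [|//]]]] // _ ->] := rowseqP y.
rewrite mul_rowseq //= => /rowseq_eq0/(_ erefl) [E1 E2 E3 _ _ _ _ _].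
have y2E : a * y2 = w * y1 by apply: (eq_of_sub E1); ring.
have y3E : a * y3 = v * y1 by apply/esym; apply: (eq_of_sub E2); ring.
have E3' : w * y3 = u * y1 by apply: (eq_of_sub E3); ring.
have y10 : y1 = 0.
  by apply: (mulfI D0); rewrite mulrBl -mulrA -E3' (mulrCA a) y3E; ring.
have y20 : y2 = 0 by apply: (mulfI a0); rewrite y2E y10; ring.
have y30 : y3 = 0 by apply: (mulfI a0); rewrite y3E y10; ring.
by rewrite y10 y20 y30; apply/rowP => -[[|[|[|//]]] ?]; rewrite !mxE.
Qed.

Lemma vmx1_tr_injective : u * u - b * c != 0 ->
  forall y : 'rV_1, y *m (vmx1 a b c u v w)^T = 0 -> y = 0.
Proof.
move=> D0 y; have [[|y1 [|//]] // _ ->] := rowseqP y.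
rewrite mul_rowseq_tr //= => /rowseq_eq0/(_ erefl) [E _ _ _ _ _].
move/eqP: E; rewrite addr0 mulf_eq0 (negPf D0) orbF => /eqP ->.
by apply/rowP => i; rewrite !mxE ord1.
Qed.

End Injectivity.

(** * Lifting exactness from X_i = 0 *)

Lemma rmorph_eq0_cancel (R : idomainType) (s : {rmorphism R -> R}) x y z p q r :
  x != 0 -> s x = x -> s y = 0 -> s z = 0 -> x * p = y * q + z * r -> s p = 0.
Proof.
move=> x0 sx sy sz /(congr1 s); rewrite rmorphD !rmorphM sx sy sz !mul0r addr0.
by move/eqP; rewrite mulf_eq0 (negPf x0) => /eqP.
Qed.

Section Truncation.
Variables (k : fieldType) (n : nat).
Local Notation S := {mpoly k[n]}.
Implicit Types (p q : S).

Definition trunc N p : S := \sum_(d < N) pihomog mdeg d p.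

Lemma mcoeff_trunc N p m : (trunc N p)@_m = if (mdeg m < N)%N then p@_m else 0.
Proof.
rewrite raddf_sum /=.
under eq_bigr => d _ do rewrite (mcoeff_hcomp d%:Z) eqz_nat.
case: ltnP => [lt_mN|le_Nm]; last first.
  by rewrite big1 // => d _; rewrite ltn_eqF // (leq_trans _ le_Nm).
rewrite (bigD1 (Ordinal lt_mN)) //= eqxx big1 ?addr0 // => d dm.
by case: eqP => // E; case/eqP: dm; exact: val_inj.
Qed.

Lemma trunc_is_linear N : linear (trunc N).
Proof.
move=> c p q; apply/mpolyP => m; rewrite mcoeffD mcoeffZ !mcoeff_trunc.
by rewrite mcoeffD mcoeffZ; case: ifP => // _; rewrite mulr0 addr0.
Qed.

HB.instance Definition _ N :=
  GRing.isLinear.Build k S S _ (trunc N) (trunc_is_linear N).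

Lemma trunc_homog N d p :
  p \is d.-homog -> trunc N p = if (d < N)%N then p else 0.
Proof.
move=> hp; apply/mpolyP => m; rewrite mcoeff_trunc.
have [<-|md] := eqVneq (mdeg m) d; first by case: ifP; rewrite ?mcoeff0.
by rewrite (dhomog_nemf_coeff hp md) !(fun_if (mcoeff m)) mcoeff0
  (dhomog_nemf_coeff hp md) !if_same.
Qed.

Lemma truncM N e p q : q \is e.-homog -> trunc (N + e) (p * q) = trunc N p * q.
Proof.
move=> hq; rewrite [p]mpolyE mulr_suml !raddf_sum /= mulr_suml.
apply: eq_bigr => m _; rewrite -scalerAl !linearZ /= -scalerAl.
rewrite (@trunc_homog _ (mdeg m + e)); last by rewrite dhomogM // dhomogX.
rewrite (@trunc_homog _ (mdeg m)) ?dhomogX // ltn_add2r.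
by case: ifP; rewrite ?mul0r.
Qed.

Lemma pihomogM d e p q :
  q \is e.-homog -> pihomog mdeg (d + e) (p * q) = pihomog mdeg d p * q.
Proof.
have truncS N r : trunc N.+1 r = trunc N r + pihomog mdeg N r.
  by rewrite /trunc big_ord_recr.
(* A homogeneous component is the difference of two consecutive truncations. *)
move=> hq; apply: (@addrI _ (trunc (d + e) (p * q))).
by rewrite -truncS -addSn !truncM // truncS mulrDl.
Qed.

Lemma trunc_id N p : (msize p <= N)%N -> trunc N p = p.
Proof.
move=> pN; apply/mpolyP => m; rewrite mcoeff_trunc; case: ltnP => // Nm.
by rewrite memN_msupp_eq0 // msize_mdeg_ge // (leq_trans pN).
Qed.

Lemma truncXM N i p : trunc N ('X_i ^+ N * p) = 0.
Proof.
rewrite mulrC -{1}[N]add0n truncM; last first.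
  by rewrite -[X in X.-homog]mul1n dhomogMn // dhomogX /= mdeg1.
by rewrite /trunc big_ord0 mul0r.
Qed.

(** Setting X_i to 0 as an endomorphism of S, rather than as a map to fewer variables, keeps all
    matrices over one ring and can be iterated. *)
Definition mkill (i : 'I_n) : S -> S :=
  comp_mpoly [tuple if j == i then 0 else 'X_j | j < n].

HB.instance Definition _ i := GRing.RMorphism.copy (mkill i) (mkill i).

Lemma mkillX i j : mkill i 'X_j = if j == i then 0 else 'X_j.
Proof. by rewrite /mkill comp_mpolyXU -tnth_nth tnth_mktuple. Qed.

Lemma mkill_sub i p : exists q, p - mkill i p = 'X_i * q.
Proof.
elim/mpolyind: p => [|c m p _ _ [q E]]; first by exists 0;
  rewrite rmorph0 subrr mulr0.
suff [q' E'] : exists q', 'X_[m] - mkill i 'X_[m] = 'X_i * q'.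
  exists (c *: q' + q); rewrite mulrDr -E -scalerAr -E' scalerBr.
  by rewrite /mkill comp_mpolyD comp_mpolyZ addrACA opprD.
have [mi|mi] := eqVneq (m i) 0%N.
  exists 0; rewrite mulr0 /mkill comp_mpolyX [X in X - _]mpolyXE_id.
  apply/eqP; rewrite subr_eq0; apply/eqP/eq_bigr => j _; rewrite tnth_mktuple.
  by case: eqP => // ->; rewrite mi !expr0.
have -> : m = (U_(i) + (m - U_(i)))%MM by rewrite addmC submK // lep1mP.
by exists 'X_[(m - U_(i))%MM];
  rewrite mpolyXD rmorphM /= mkillX eqxx mul0r subr0.
Qed.

Lemma mkill_id i p : mkill i (mkill i p) = mkill i p.
Proof.
have [q E] := mkill_sub i p; apply/esym/eqP; rewrite -subr_eq0 -rmorphB E.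
by rewrite rmorphM /= mkillX eqxx mul0r.
Qed.

Lemma mkill_eq0 i p : mkill i p = 0 -> exists q, p = 'X_i * q.
Proof. by move=> p0; have [q] := mkill_sub i p; rewrite p0 subr0; exists q. Qed.

Lemma var_homog (i : 'I_n) : ('X_i : S) \is 1.-homog.
Proof. by rewrite dhomogX /= mdeg1. Qed.

Lemma var_neq0 (i : 'I_n) : ('X_i : S) != 0.
Proof. by rewrite -msize_poly_eq0 msizeX. Qed.

Lemma mkill_regular (i j : 'I_n) p q : i != j ->
  'X_j * p = 'X_i * q -> exists r, p = 'X_i * r.
Proof.
move=> ij /(congr1 (mkill i));
  rewrite !rmorphM /= !mkillX eqxx eq_sym (negPf ij).
by rewrite mul0r => /eqP;
  rewrite mulf_eq0 (negPf (var_neq0 j)) => /eqP/mkill_eq0.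
Qed.

Lemma mkill_regular2 (i j l : 'I_n) (p q r : S) : i != l -> j != l ->
  'X_l * p = 'X_i * q + 'X_j * r -> exists s t, p = 'X_i * s + 'X_j * t.
Proof.
move=> il jl; have lE : mkill i (mkill j 'X_l) = 'X_l :> S.
  by rewrite mkillX eq_sym (negPf jl) mkillX eq_sym (negPf il).
have iE : mkill i (mkill j 'X_i) = 0 :> S.
  by rewrite mkillX; case: ifP; rewrite ?rmorph0 ?mkillX ?eqxx.
have jE : mkill i (mkill j 'X_j) = 0 :> S by rewrite mkillX eqxx rmorph0.
move=> E; have [s pE] : exists s, mkill j p = 'X_i * s.
  apply: mkill_eq0.
  exact: (rmorph_eq0_cancel (s := mkill i \o mkill j) (var_neq0 l) lE iE jE E).
have [t tE] := mkill_sub j p; exists s, t.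
by rewrite -pE -tE addrC subrK.
Qed.

Lemma map_mx_truncM N e m1 m2 m3 (A : 'M[S]_(m1, m2)) (B : 'M[S]_(m2, m3)) :
  (forall i j, B i j \is e.-homog) ->
  map_mx (trunc (N + e)) (A *m B) = map_mx (trunc N) A *m B.
Proof.
move=> hB; apply/matrixP => i j; rewrite !mxE raddf_sum /=.
by apply: eq_bigr => l _; rewrite !mxE truncM.
Qed.

(* Graded Nakayama: a cycle is a boundary modulo every power of X_i, and by
   homogeneity of [A] truncating modulo a high power gives an exact preimage. *)
Lemma exact_mkill i e m1 m2 m3 (A : 'M[S]_(m1, m2)) (B : 'M[S]_(m2, m3)) :
  (forall i j, A i j \is e.-homog) -> A *m B = 0 ->
  exact_mx (map_mx (mkill i) A) (map_mx (mkill i) B) -> exact_mx A B.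
Proof.
move=> hA AB exAB.
have step (y : 'rV_m2) : y *m B = 0 ->
    exists z y', y = z *m A + 'X_i *: y' /\ y' *m B = 0.
  move=> yB; have [|z zE] := exAB (map_mx (mkill i) y).
    by rewrite -map_mxM yB map_mx0.
  have /choice[y' y'E] j : exists y'j, (y - map_mx (mkill i) z *m A) 0 j = 'X_i
    * y'j.
    apply: mkill_eq0.
    suff /rowP/(_ j) : map_mx (mkill i) (y - map_mx (mkill i) z *m A) = 0
      by rewrite !mxE.
    have idem n1 n2 (M : 'M[S]_(n1, n2)) : map_mx (mkill i) (map_mx (mkill i) M)
      = map_mx (mkill i) M.
      by apply/matrixP => i' j'; rewrite !mxE mkill_id.
    have := congr1 (map_mx (mkill i)) zE.
    by rewrite map_mxB !map_mxM !idem => ->; rewrite subrr.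
  have E : y = map_mx (mkill i) z *m A + 'X_i *: \row_j y' j.
    by apply/rowP => j; rewrite !mxE -y'E !mxE addrC subrK.
  exists (map_mx (mkill i) z), (\row_j y' j); split=> //.
  (* X_i is a nonzerodivisor of S, so the remainder is again a cycle and the step can be
     repeated. *)
  have : 'X_i *: (\row_j y' j *m B) = 0.
    by have := yB; rewrite E mulmxDl -mulmxA AB mulmx0 add0r scalemxAl.
  by move/eqP; rewrite scalemx_eq0 -msize_poly_eq0 msizeX => /eqP.
have steps N (y : 'rV_m2) : y *m B = 0 ->
    exists z y', y = z *m A + 'X_i ^+ N *: y' /\ y' *m B = 0.
  elim: N => [|N IHN] in y *; first by exists 0, y;
    rewrite mul0mx add0r scale1r.
  move=> /step[z [y1 [-> /IHN[z' [y' [-> y'B]]]]]].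
  exists (z + 'X_i *: z'), y'; split=> //.
  by rewrite scalerDr scalerA -exprS mulmxDl -scalemxAl addrA.
(* Truncation below N + e leaves [y] unchanged and kills multiples of X_i^(N + e); on z A it acts as
   truncation of [z] below N, since A has degree e. *)
move=> y yB; pose N := (\max_j msize (y 0%R j))%N.
have [z [y' [E _]]] := steps (N + e)%N y yB.
exists (map_mx (trunc N) z).
have <- : map_mx (trunc (N + e)) y = y.
  apply/rowP => j; rewrite mxE trunc_id //.
  by rewrite (leq_trans _ (leq_addr _ _)) // (leq_bigmax j).
rewrite E raddfD /= (map_mx_truncM _ _ hA) -[RHS]addr0; congr (_ + _).
by apply/matrixP => i' j; rewrite !mxE truncXM.
Qed.

End Truncation.

(** * Normal forms and the two kernels *)

(* [phi] sends monomials to monomials and [tau m] is a normal form, modulo the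
   rows of [A], of the terms whose image is the monomial m. Then every element
   is congruent to the combination of the [tau m] prescribed by its image, so
   an element with image 0 lies in the row space of [A]. *)
Section MonomialSection.
Variables (k : fieldType) (n n' r s : nat).
Local Notation S := {mpoly k[n]}.
Local Notation T := {mpoly k[n']}.
Variables (V : 'I_n -> 'X_{1..n'}) (E : 'I_r -> 'X_{1..n'}).
Variables (phi : {rmorphism S -> T}) (A : 'M[S]_(s, r)).
Variable tau : 'X_{1..n'} -> 'rV[S]_r.
Hypothesis phiC : forall c, phi c%:MP = c%:MP.
Hypothesis phiX : forall j, phi 'X_j = 'X_[V j].

Local Notation inA := (in_rows A).

Hypothesis tauE : forall i, inA (delta_mx 0 i - tau (E i)).
Hypothesis tauX : forall j m, inA ('X_j *: tau m - tau (V j + m)%MM).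

Lemma in_rowsD x y : inA x -> inA y -> inA (x + y).
Proof. by move=> [z ->] [t ->]; exists (z + t); rewrite mulmxDl. Qed.

Lemma in_rowsZ p x : inA x -> inA (p *: x).
Proof. by move=> [z ->]; exists (p *: z); rewrite scalemxAl. Qed.

Lemma mnm_ind (P : 'X_{1..n} -> Prop) :
  P 0%MM -> (forall i m, P m -> P (U_(i) + m)%MM) -> forall m, P m.
Proof.
move=> P0 PU m; have [N] := ubnP (mdeg m); elim: N m => // N IHN m mN.
have [->//|m0] := eqVneq m 0%MM.
have [i mi] : exists i, m i != 0%N.
  apply/existsP; rewrite -[X in is_true X]negbK negb_exists; apply: contra m0.
  by move/forallP => m0; apply/eqP/mnmP => i; rewrite mnm0E; apply/eqP/negPn/m0.
have mE : m = (U_(i) + (m - U_(i)))%MM by rewrite addmC submK // lep1mP.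
rewrite mE; apply/PU/IHN; rewrite -ltnS (leq_trans _ mN) // ltnS mE.
by rewrite [in X in (_ < X)%N]mdegD mdeg1 add1n ltnS addmC addmK.
Qed.

Lemma monomial_normal_form m : exists m',
  phi 'X_[m] = 'X_[m'] /\
  forall i, inA ('X_[m] *: delta_mx 0 i - tau (m' + E i)%MM).
Proof.
elim/mnm_ind: m => [|j m [m' [phim IHm]]].
  exists 0%MM; rewrite mpolyX0 rmorph1; split=> [|i]; first by rewrite mpolyX0.
  by rewrite add0m scale1r.
exists (V j + m')%MM; split=> [|i].
  by rewrite !mpolyXD rmorphM /= phiX phim.
rewrite mpolyXD.
have := in_rowsD (in_rowsZ 'X_j (IHm i)) (tauX j (m' + E i)).
by rewrite scalerBr scalerA addrA subrK addmA.
Qed.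

(** The k-linear extension of [tau], cut off at degree K to make the sum finite; it is additive for
    each fixed K and faithful once K exceeds the degrees involved. *)
Definition tau_lin K (q : T) : 'rV[S]_r :=
  \sum_(m : 'X_{1..n' < K}) (q@_m)%:MP *: tau m.

Lemma tau_linD K p q : tau_lin K (p + q) = tau_lin K p + tau_lin K q.
Proof.
rewrite -big_split; apply: eq_bigr => m _ /=.
by rewrite mcoeffD mpolyCD scalerDl.
Qed.

Lemma tau_linZX K c m : (mdeg m < K)%N ->
  tau_lin K (c *: 'X_[m]) = c%:MP *: tau m.
Proof.
move=> mK; rewrite /tau_lin (bigD1 (BMultinom mK)) //= mcoeffZ mcoeffX eqxx.
rewrite mulr1 big1 ?addr0 // => m' ne; rewrite mcoeffZ mcoeffX.
case: eqP => [E'|_]; last by rewrite mulr0 scale0r.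
by case/eqP: ne; apply: val_inj; rewrite /= E'.
Qed.

Lemma polynomial_normal_form p i : exists K0, forall K, (K0 <= K)%N ->
  inA (p *: delta_mx 0 i - tau_lin K (phi p * 'X_[E i])).
Proof.
elim/mpolyind: p => [|c m p _ _ [K0 IHp]].
  exists 0%N => K _; exists 0; rewrite rmorph0 mul0r mul0mx scale0r sub0r.
  by rewrite /tau_lin big1 ?oppr0 // => m _; rewrite mcoeff0 mpolyC0 scale0r.
have [m' [phim nf]] := monomial_normal_form m.
exists (maxn K0 (mdeg (m' + E i)).+1) => K;
  rewrite geq_max => /andP[/IHp K0K mK].
have := in_rowsD (in_rowsZ c%:MP (nf i)) K0K.
rewrite -!mul_mpolyC rmorphD rmorphM /= phiC phim mulrDl -mulrA -mpolyXD.
rewrite tau_linD [_%:MP * 'X_[m' + _]]mul_mpolyC tau_linZX // scalerDl.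
by rewrite scalerBr scalerA addrACA opprD.
Qed.

Lemma normal_form_kernel (p : 'rV[S]_r) :
  \sum_i phi (p 0 i) * 'X_[E i] = 0 -> inA p.
Proof.
move=> p0; have /choice[K0 nf] i := polynomial_normal_form (p 0 i) i.
pose K := (\max_i K0 i)%N.
have tau0 : tau_lin K 0 = 0.
  by rewrite /tau_lin big1 // => m _; rewrite mcoeff0 mpolyC0 scale0r.
have -> : p = \sum_i
    (p 0 i *: delta_mx 0 i - tau_lin K (phi (p 0 i) * 'X_[E i])).
  rewrite sumrB -(big_morph _ (tau_linD K) tau0) p0 tau0 subr0.
  exact: row_sum_delta.
elim/big_ind: _ => [|x y|i _]; first by exists 0; rewrite mul0mx.
  exact: in_rowsD.
by apply: nf; exact: leq_bigmax.
Qed.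

End MonomialSection.

Section NormalFormTables.
Variables (R : comNzRingType) (a b c u v w : R).

(* Normal forms of the monomials of T whose exponents are 0 or 1, indexed by
   exponent parities; parities of the wrong total degree get the value 0. *)
Definition even_rep (e0 e1 e2 : bool) : 'rV[R]_1 := rowseq 1 [::
  match e0, e1, e2 with
  | false, false, false => 1
  | false, true, true => u
  | true, false, true => v
  | true, true, false => w
  | _, _, _ => 0
  end].

Definition odd_rep (e0 e1 e2 : bool) : 'rV[R]_3 := rowseq 3
  match e0, e1, e2 with
  | true, false, false => [:: 1; 0; 0]
  | false, true, false => [:: 0; 1; 0]
  | false, false, true => [:: 0; 0; 1]
  | true, true, true => [:: u; 0; 0]
  | _, _, _ => [:: 0; 0; 0]
  end.

(** Multiplying by x_i x_j flips two parities, and each of the two exponents that was odd completes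
    a square, which leaves as a, b or c. The squares themselves change no parity and need no
    relation. *)
Definition parity_relations r s (A : 'M[R]_(s, r))
    (G : bool -> bool -> bool -> 'rV[R]_r) :=
  forall e0 e1 e2, let g := G e0 e1 e2 in
  [/\ in_rows A (u *: g - (b ^+ e1 * c ^+ e2) *: G e0 (~~ e1) (~~ e2)),
      in_rows A (v *: g - (a ^+ e0 * c ^+ e2) *: G (~~ e0) e1 (~~ e2))
    & in_rows A (w *: g - (a ^+ e0 * b ^+ e1) *: G (~~ e0) (~~ e1) e2)].

Lemma even_rep_relations : parity_relations (vmx1 a b c u v w) even_rep.
Proof.
(* Every difference is 0 or exactly one of the six minors, selected by a unit vector. *)
pose z i := rowseq 6 (set_nth 0 [:: 0; 0; 0; 0; 0; 0] i (1 : R)).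
have z0 (y : 'rV[R]_1) : y = 0 -> in_rows (vmx1 a b c u v w) y.
  by move=> ->; exists 0; rewrite mul0mx.
by case=> [] [] []; split;
  first [ apply: z0; apply/rowP => j; rewrite !mxE ord1 /=; ring
        | exists (z 0%N); apply/rowP => j;
          rewrite mul_rowseq //= !mxE ord1 /=; ring
        | exists (z 1%N); apply/rowP => j;
          rewrite mul_rowseq //= !mxE ord1 /=; ring
        | exists (z 2%N); apply/rowP => j;
          rewrite mul_rowseq //= !mxE ord1 /=; ring
        | exists (z 3%N); apply/rowP => j;
          rewrite mul_rowseq //= !mxE ord1 /=; ring
        | exists (z 4%N); apply/rowP => j;
          rewrite mul_rowseq //= !mxE ord1 /=; ring
        | exists (z 5%N); apply/rowP => j;
          rewrite mul_rowseq //= !mxE ord1 /=; ring ].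
Qed.

Lemma row_vmx3_tr (t : seq R) (x : 'rV[R]_3) : size t = 8 ->
  (forall i : 'I_3, x 0 i = [seq dot t r | r <-
    [:: [:: - w; v; - u; b; 0; 0; - c; 0];
        [:: a; 0; 0; - w; v; - u; 0; c];
        [:: 0; - a; w; 0; - w; b; v; - u]]]`_i) ->
  in_rows (vmx3 a b c u v w)^T x.
Proof.
move=> t8 xE; exists (rowseq 8 t); rewrite mul_rowseq_tr //.
by apply/rowP => i; rewrite xE mxE.
Qed.

Ltac row_vmx3_tac t :=
  by apply: (row_vmx3_tr (t := t)) => // -[[|[|[|//]]] ?]; rewrite !mxE /=;
    ring.

(** Each list gives the coefficients of the columns of [vmx3] in the difference, and is zero where
    the difference vanishes. Representing x0 x1 x2 by u times the first generator is an asymmetric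
    choice, which costs linear coefficients in the first three cases. *)
Lemma odd_rep_relations : parity_relations (vmx3 a b c u v w)^T odd_rep.
Proof.
case=> [] [] []; split.
- row_vmx3_tac ([:: 0; 0; - u; - c; 0; 0; 0; - w] : seq R).
- row_vmx3_tac ([:: 0; u; 0; 0; 0; 0; 0; - a] : seq R).
- row_vmx3_tac ([:: - u; 0; 0; 0; 0; - a; 0; 0] : seq R).
- row_vmx3_tac ([:: 0; 0; 0; 0; 0; 0; 0; 0] : seq R).
- row_vmx3_tac ([:: 0; 0; 0; 0; 0; 0; 0; 0] : seq R).
- row_vmx3_tac ([:: 0; 0; 0; 0; 0; 0; 0; 0] : seq R).
- row_vmx3_tac ([:: 0; 0; 0; 0; 0; 0; 0; 0] : seq R).
- row_vmx3_tac ([:: 0; 0; 0; 0; 0; 0; 0; 0] : seq R).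
- row_vmx3_tac ([:: 0; 0; 0; 0; 0; 0; 0; 0] : seq R).
- row_vmx3_tac ([:: 0; 0; 0; 0; 0; 0; 0; 0] : seq R).
- row_vmx3_tac ([:: 0; 1; 0; 0; 0; 0; 0; 0] : seq R).
- row_vmx3_tac ([:: - 1; 0; 0; 0; 0; 0; 0; 0] : seq R).
- row_vmx3_tac ([:: 0; 0; 0; 0; 0; 0; 0; 0] : seq R).
- row_vmx3_tac ([:: 0; 0; 0; 0; 0; 0; 0; 0] : seq R).
- row_vmx3_tac ([:: 0; 0; 0; 0; 0; 0; 0; 0] : seq R).
- row_vmx3_tac ([:: 0; 0; 0; 0; 0; - 1; 0; 0] : seq R).
- row_vmx3_tac ([:: 0; 0; 1; 0; 1; 0; 0; 0] : seq R).
- row_vmx3_tac ([:: 0; 0; 0; - 1; 0; 0; 0; 0] : seq R).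
- row_vmx3_tac ([:: 0; 0; 0; 0; 0; 0; 0; - 1] : seq R).
- row_vmx3_tac ([:: 0; 0; 0; 0; 0; 0; 1; 0] : seq R).
- row_vmx3_tac ([:: 0; 0; 1; 0; 0; 0; 0; 0] : seq R).
- row_vmx3_tac ([:: 0; 0; 0; 0; 0; 0; 0; 0] : seq R).
- row_vmx3_tac ([:: 0; 0; 0; 0; 0; 0; 0; 0] : seq R).
- row_vmx3_tac ([:: 0; 0; 0; 0; 0; 0; 0; 0] : seq R).
Qed.

End NormalFormTables.

Lemma ord6_ind (P : 'I_6 -> Prop) :
  P (Ordinal (isT : 0 < 6)%N) -> P (Ordinal (isT : 1 < 6)%N) ->
  P (Ordinal (isT : 2 < 6)%N) -> P (Ordinal (isT : 3 < 6)%N) ->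
  P (Ordinal (isT : 4 < 6)%N) -> P (Ordinal (isT : 5 < 6)%N) -> forall j, P j.
Proof.
move=> P0 P1 P2 P3 P4 P5 j.
by case: j => [[|[|[|[|[|[|j]]]]]] j6] //;
  rewrite (bool_irrelevance j6 isT).
Qed.

(** * The Veronese surface *)

Section Veronese_surface.
Variable k : fieldType.
Local Notation S := {mpoly k[6]}.
Local Notation T := {mpoly k[3]}.
Local Notation "''Y_' i" :=
  ('X_(@Ordinal 6 i isT) : S) (at level 8, i at level 2).
Local Notation y00 := 'Y_0.
Local Notation y01 := 'Y_1.
Local Notation y02 := 'Y_2.
Local Notation y11 := 'Y_3.
Local Notation y12 := 'Y_4.
Local Notation y22 := 'Y_5.
Local Notation i0 := (@Ordinal 3 0 isT).
Local Notation i1 := (@Ordinal 3 1 isT).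
Local Notation i2 := (@Ordinal 3 2 isT).

Definition veronese_exp : 'I_6 -> 'X_{1..3} := tnth [tuple
  (U_(i0) + U_(i0))%MM; (U_(i0) + U_(i1))%MM; (U_(i0) + U_(i2))%MM;
  (U_(i1) + U_(i1))%MM; (U_(i1) + U_(i2))%MM; (U_(i2) + U_(i2))%MM].

Definition veronese_map : S -> T :=
  comp_mpoly [tuple 'X_[veronese_exp j] | j < 6].

HB.instance Definition _ := GRing.RMorphism.copy veronese_map veronese_map.

Lemma veronese_mapC c : veronese_map c%:MP = c%:MP.
Proof. exact: comp_mpolyC. Qed.

Lemma veronese_mapX j : veronese_map 'X_j = 'X_[veronese_exp j].
Proof. by rewrite /veronese_map comp_mpolyXU -tnth_nth tnth_mktuple. Qed.

Lemma meval_veronese (g : S) (x : 'I_3 -> k) :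
  (veronese_map g).@[x] = g.@[veronese x].
Proof.
rewrite comp_mpoly_meval; apply: meval_eq => j;
  rewrite tnth_mktuple /veronese /veronese_exp.
have E (i : 'I_3) : inord i = i by exact: inord_val.
rewrite (E i0) (E i1) (E i2).
by case: j => [[|[|[|[|[|[|//]]]]]] j6];
  rewrite !(tnth_nth 0) !(tnth_nth 0%MM) /= mpolyXD mevalM !mevalXU ?expr2.
Qed.

Definition half_mon (m : 'X_{1..3}) : S :=
  y00 ^+ (m i0)./2 * y11 ^+ (m i1)./2 * y22 ^+ (m i2)./2.

Definition tau r (G : bool -> bool -> bool -> 'rV[S]_r) (m : 'X_{1..3}) :=
  half_mon m *: G (odd (m i0)) (odd (m i1)) (odd (m i2)).

Lemma tauE r (G : bool -> bool -> bool -> 'rV[S]_r) (m : 'X_{1..3}) (e0 e1 e2 :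
  bool) h0 h1 h2 :
  m i0 = (e0 + h0.*2)%N -> m i1 = (e1 + h1.*2)%N -> m i2 = (e2 + h2.*2)%N ->
  tau G m = (y00 ^+ h0 * y11 ^+ h1 * y22 ^+ h2) *: G e0 e1 e2.
Proof.
move=> E0 E1 E2; rewrite /tau /half_mon E0 E1 E2 !half_bit_double.
by rewrite !oddD !odd_double !addbF !oddb.
Qed.

Lemma veronese_expE j : veronese_exp j = nth 0%MM
  [:: (U_(i0) + U_(i0))%MM; (U_(i0) + U_(i1))%MM; (U_(i0) + U_(i2))%MM;
      (U_(i1) + U_(i1))%MM; (U_(i1) + U_(i2))%MM; (U_(i2) + U_(i2))%MM] j.
Proof. by rewrite /veronese_exp (tnth_nth 0%MM). Qed.

Lemma tau_relations r s (A : 'M[S]_(s, r)) G :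
  parity_relations y00 y11 y22 y12 y02 y01 A G ->
  forall j m, in_rows A ('X_j *: tau G m - tau G (veronese_exp j + m)%MM).
Proof.
move=> rel j m.
set e0 := odd (m i0); set e1 := odd (m i1); set e2 := odd (m i2).
set h0 := (m i0)./2; set h1 := (m i1)./2; set h2 := (m i2)./2.
have E0 : m i0 = (e0 + h0.*2)%N by rewrite odd_double_half.
have E1 : m i1 = (e1 + h1.*2)%N by rewrite odd_double_half.
have E2 : m i2 = (e2 + h2.*2)%N by rewrite odd_double_half.
rewrite (tauE G E0 E1 E2).
have [Hu Hv Hw] := rel e0 e1 e2.
(* Adding 1 to an exponent flips its parity [e] and carries [e] into the half; adding 2 only raises
   the half. *)
have flip (e : bool) h n : n = (e + h.*2)%N -> (1 + n = ~~ e + (e + h).*2)%N.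
  by move=> ->; case: e; rewrite /= ?add1n ?add0n // doubleS.
have shift (e : bool) h n : n = (e + h.*2)%N -> (2 + n = e + h.+1.*2)%N.
  by move=> ->; rewrite doubleS add2n !addnS.
have scale0 (x y : S) (g : 'rV[S]_r) : x = y -> in_rows A (x *: g - y *: g).
  by move=> ->; rewrite subrr; exists 0; rewrite mul0mx.
have fact (x p q t : S) (g g' : 'rV[S]_r) : q = p * t ->
    in_rows A (x *: g - t *: g') -> in_rows A (x *: (p *: g) - q *: g').
  move=> -> H; rewrite scalerA mulrC -!scalerA -scalerBr; exact: in_rowsZ.
have vE i : (veronese_exp j + m)%MM i = (veronese_exp j i + m i)%N
  by rewrite mnmDE.
have sq (x p q : S) (g : 'rV[S]_r) : x * p = q -> in_rows A (x *: (p *: g) - q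
  *: g).
  by move=> xpq; rewrite scalerA; exact: scale0.
move: j vE; apply: ord6_ind => vE.
- rewrite (@tauE _ _ _ e0 e1 e2 h0.+1 h1 h2) ?vE ?veronese_expE /nth ?mnmDE
    ?mnm1E;
    [|exact: shift|exact: E1|exact: E2].
  by apply: sq => //; rewrite exprS !mulrA.
- rewrite (@tauE _ _ _ (~~ e0) (~~ e1) e2 (e0 + h0) (e1 + h1) h2)
    ?vE ?veronese_expE /nth ?mnmDE ?mnm1E; [|exact: flip|exact: flip|exact: E2].
  by apply: fact Hw; rewrite !exprD; ring.
- rewrite (@tauE _ _ _ (~~ e0) e1 (~~ e2) (e0 + h0) h1 (e2 + h2))
    ?vE ?veronese_expE /nth ?mnmDE ?mnm1E; [|exact: flip|exact: E1|exact: flip].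
  by apply: fact Hv; rewrite !exprD; ring.
- rewrite (@tauE _ _ _ e0 e1 e2 h0 h1.+1 h2) ?vE ?veronese_expE /nth ?mnmDE
    ?mnm1E;
    [|exact: E0|exact: shift|exact: E2].
  by apply: sq => //; rewrite exprS; ring.
- rewrite (@tauE _ _ _ e0 (~~ e1) (~~ e2) h0 (e1 + h1) (e2 + h2))
    ?vE ?veronese_expE /nth ?mnmDE ?mnm1E; [|exact: E0|exact: flip|exact: flip].
  by apply: fact Hu; rewrite !exprD; ring.
- rewrite (@tauE _ _ _ e0 e1 e2 h0 h1 h2.+1) ?vE ?veronese_expE /nth ?mnmDE
    ?mnm1E;
    [|exact: E0|exact: E1|exact: shift].
  by apply: sq => //; rewrite exprS; ring.
Qed.

Local Notation M1 := (vmx1 y00 y11 y22 y12 y02 y01).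
Local Notation M2 := (vmx2 y00 y11 y22 y12 y02 y01).
Local Notation M3 := (vmx3 y00 y11 y22 y12 y02 y01).

Lemma mxseq_homog m n rs d : all (all (fun p : S => p \is d.-homog)) rs ->
  forall i j, mxseq m n rs i j \is d.-homog.
Proof.
move=> /allP hrs i j; rewrite mxE.
have [irs|irs] := ltnP i (size rs);
  last by rewrite (nth_default _ irs) nth_nil dhomog0.
have /allP hr := hrs _ (mem_nth [::] irs).
have [jr|jr] := ltnP j (size (nth [::] rs i));
  last by rewrite nth_default ?dhomog0.
exact/hr/mem_nth.
Qed.

Section Homogeneous_entries.
Variables a b c u v w : S.
Hypothesis h : [/\ [/\ a \is 1.-homog, b \is 1.-homog & c \is 1.-homog],
  u \is 1.-homog, v \is 1.-homog & w \is 1.-homog].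

Lemma vmx1_homog i j : vmx1 a b c u v w i j \is 2.-homog.
Proof.
have [[ha hb hc] hu hv hw] := h.
by apply: mxseq_homog; rewrite /= !rpredB ?(dhomogM (d := 1) (e := 1)).
Qed.

Lemma vmx2_homog i j : vmx2 a b c u v w i j \is 1.-homog.
Proof.
have [[ha hb hc] hu hv hw] := h.
by apply: mxseq_homog; rewrite /= !dhomogN !dhomog0 ha hb hc hu hv hw.
Qed.

Lemma vmx3_homog i j : vmx3 a b c u v w i j \is 1.-homog.
Proof.
have [[ha hb hc] hu hv hw] := h.
by apply: mxseq_homog; rewrite /= !dhomogN !dhomog0 ha hb hc hu hv hw.
Qed.

End Homogeneous_entries.

Lemma M1_homog i j : M1 i j \is 2.-homog.
Proof. by apply: vmx1_homog; do !split; exact: var_homog. Qed.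

Lemma M2_homog i j : M2 i j \is 1.-homog.
Proof. by apply: vmx2_homog; do !split; exact: var_homog. Qed.

Lemma M3_homog i j : M3 i j \is 1.-homog.
Proof. by apply: vmx3_homog; do !split; exact: var_homog. Qed.

(** Stated for families in a, b, c that commute with substitution, so that killing one diagonal
    variable stays within the family; this serves both complexes at both inner spots. *)
Lemma exact_of_degenerate m1 m2 m3 d
    (A : S -> S -> S -> 'M[S]_(m1, m2)) (B : S -> S -> S -> 'M[S]_(m2, m3)) :
  (forall a b c, [/\ a \is 1.-homog, b \is 1.-homog & c \is 1.-homog] ->
    forall i j, A a b c i j \is d.-homog) ->
  (forall a b c, A a b c *m B a b c = 0) ->
  (forall (f : {rmorphism S -> S}) a b c,
    f y12 = y12 -> f y02 = y02 -> f y01 = y01 ->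
    map_mx f (A a b c) = A (f a) (f b) (f c) /\
    map_mx f (B a b c) = B (f a) (f b) (f c)) ->
  exact_mx (A 0 0 0) (B 0 0 0) -> exact_mx (A y00 y11 y22) (B y00 y11 y22).
Proof.
move=> hA AB fE ex0.
have h0 : (0 : S) \is 1.-homog by exact: dhomog0.
have h1 i : ('X_i : S) \is 1.-homog by exact: var_homog.
apply: (@exact_mkill _ _ (@Ordinal 6 0 isT) d) => //; first exact: hA.
have [| | | -> ->] := fE [the {rmorphism _ -> _} of mkill (@Ordinal 6 0 isT)]
  y00 y11 y22;
  [by rewrite /= mkillX ..|].
rewrite /= !mkillX /=.
apply: (@exact_mkill _ _ (@Ordinal 6 3 isT) d) => //; first exact: hA.
have [| | | -> ->] := fE [the {rmorphism _ -> _} of mkill (@Ordinal 6 3 isT)] 0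
  y11 y22;
  [by rewrite /= mkillX ..|].
rewrite rmorph0 /= !mkillX /=.
apply: (@exact_mkill _ _ (@Ordinal 6 5 isT) d) => //; first exact: hA.
have [| | | -> ->] := fE [the {rmorphism _ -> _} of mkill (@Ordinal 6 5 isT)] 0
  0 y22;
  [by rewrite /= mkillX ..|].
by rewrite !rmorph0 /= !mkillX /=.
Qed.

Lemma exact_M2_M1 : exact_mx M2 M1.
Proof.
apply: (@exact_of_degenerate 8 6 1 1 (fun a b c => vmx2 a b c y12 y02 y01)
  (fun a b c => vmx1 a b c y12 y02 y01)) => [a b c h|a b c|f a b c fu fv fw|].
- by apply: vmx2_homog; split; rewrite ?var_homog.
- exact: vmx2_vmx1.
- by rewrite map_vmx2 map_vmx1 fu fv fw.
apply: exact_d2_d1; first exact: var_neq0.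
  by move=> p q; apply: mkill_regular.
by move=> p q r; apply: mkill_regular2.
Qed.

Lemma exact_M3_M2 : exact_mx M3 M2.
Proof.
apply: (@exact_of_degenerate 3 8 6 1 (fun a b c => vmx3 a b c y12 y02 y01)
  (fun a b c => vmx2 a b c y12 y02 y01)) => [a b c h|a b c|f a b c fu fv fw|].
- by apply: vmx3_homog; split; rewrite ?var_homog.
- exact: vmx3_vmx2.
- by rewrite map_vmx3 map_vmx2 fu fv fw.
apply: exact_d3_d2; first exact: var_neq0.
  by move=> p q; apply: mkill_regular.
Qed.

Lemma exact_M1T_M2T : exact_mx M1^T M2^T.
Proof.
apply: (@exact_of_degenerate 1 6 8 2 (fun a b c => (vmx1 a b c y12 y02 y01)^T)
  (fun a b c => (vmx2 a b c y12 y02 y01)^T)) =>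
    [a b c h i j|a b c|f a b c fu fv fw|].
- by rewrite mxE; apply: vmx1_homog; split; rewrite ?var_homog.
- by rewrite -trmx_mul vmx2_vmx1 trmx0.
- by rewrite -!map_trmx map_vmx2 map_vmx1 fu fv fw.
apply: exact_d1T_d2T; first exact: var_neq0.
by move=> p q; apply: mkill_regular.
Qed.

Lemma exact_M2T_M3T : exact_mx M2^T M3^T.
Proof.
apply: (@exact_of_degenerate 6 8 3 1 (fun a b c => (vmx2 a b c y12 y02 y01)^T)
  (fun a b c => (vmx3 a b c y12 y02 y01)^T)) =>
    [a b c h i j|a b c|f a b c fu fv fw|].
- by rewrite mxE; apply: vmx2_homog; split; rewrite ?var_homog.
- by rewrite -trmx_mul vmx3_vmx2 trmx0.
- by rewrite -!map_trmx map_vmx3 map_vmx2 fu fv fw.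
apply: exact_d2T_d3T; first exact: var_neq0.
  by move=> p q; apply: mkill_regular.
by move=> p q r; apply: mkill_regular2.
Qed.

Lemma minor_neq0 (i j l h : 'I_6) : i != l -> i != h ->
  'X_i * 'X_j - 'X_l * 'X_h != 0 :> S.
Proof.
move=> il ih; apply/eqP => /(congr1 (mkill i)).
rewrite rmorphB !rmorphM rmorph0 /= !mkillX eqxx mul0r sub0r eq_sym (negPf il).
rewrite eq_sym (negPf ih) => /eqP; rewrite oppr_eq0 mulf_eq0.
by rewrite !(negPf (var_neq0 _ _)).
Qed.

Lemma M3_injective (y : 'rV_3) : y *m M3 = 0 -> y = 0.
Proof. by apply: vmx3_injective; [exact: var_neq0 | exact: minor_neq0]. Qed.

Lemma M1T_injective (y : 'rV_1) : y *m M1^T = 0 -> y = 0.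
Proof. by apply: vmx1_tr_injective; exact: minor_neq0. Qed.

(** The augmentation from S^3 onto T_odd of the transposed complex. *)
Definition odd_eval (y : 'rV[S]_3) : T := \sum_i veronese_map (y 0 i) * 'X_i.

Lemma kernel_even (p : 'rV[S]_1) : veronese_map (p 0 0) = 0 -> in_rows M1 p.
Proof.
move=> p0; apply: (@normal_form_kernel k 6 3 1 6 veronese_exp (fun=> 0%MM)
  [the {rmorphism _ -> _} of veronese_map] M1 (tau (even_rep y12 y02 y01))).
- exact: veronese_mapC.
- exact: veronese_mapX.
- move=> i; exists 0; rewrite mul0mx (@tauE _ _ _ false false false 0 0 0)
    ?mnm0E //.
  rewrite !expr0 !mulr1 scale1r; apply/rowP => j.
  by rewrite !mxE !ord1 /= subrr.
- exact: tau_relations (even_rep_relations _ _ _ _ _ _).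
by rewrite big_ord1 /= p0 mul0r.
Qed.

Lemma kernel_odd (y : 'rV[S]_3) : odd_eval y = 0 -> in_rows M3^T y.
Proof.
move=> p0; apply: (@normal_form_kernel k 6 3 3 8 veronese_exp (fun i =>
  U_(i)%MM)
  [the {rmorphism _ -> _} of veronese_map] M3^T (tau (odd_rep y12))) => //.
- exact: veronese_mapC.
- exact: veronese_mapX.
- move=> i; exists 0; rewrite mul0mx.
  case: i => [[|[|[|//]]] i3];
    [rewrite (@tauE _ _ _ true false false 0 0 0) ?mnm1E //
    |rewrite (@tauE _ _ _ false true false 0 0 0) ?mnm1E //
    |rewrite (@tauE _ _ _ false false true 0 0 0) ?mnm1E //];
  rewrite !expr0 !mulr1 scale1r; apply/rowP => -[[|[|[|//]]] ?];
  by rewrite !mxE /= ?subrr ?subr0.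
exact: tau_relations (odd_rep_relations _ _ _ _ _ _).
Qed.

(** Any lift through a homogeneous [A] may be replaced by its component of degree d. *)
Lemma lift_homog m1 m2 l d e (A : 'M[S]_(m1, m2)) (M : 'M[S]_(l, m2)) :
  (forall i j, A i j \is e.-homog) -> (forall i, in_rows A (row i M)) ->
  (forall i j, M i j \is (d + e).-homog) ->
  exists2 Z : 'M[S]_(l, m1), M = Z *m A & forall i j, Z i j \is d.-homog.
Proof.
move=> hA /choice[z zE] hM.
exists (\matrix_(i, j) pihomog mdeg d (z i 0 j)) => [|i j];
  last by rewrite mxE pihomogP.
apply/matrixP => i j; rewrite -(pihomog_dE (hM i j)).
have /rowP/(_ j) := zE i; rewrite !mxE => ->; rewrite raddf_sum /=.
by apply: eq_bigr => h _; rewrite mxE (pihomogM _ _ (hA h j)).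
Qed.

Lemma mdeg3 (m : 'X_{1..3}) : mdeg m = (m i0 + m i1 + m i2)%N.
Proof.
rewrite mdegE !big_ord_recl big_ord0 addn0 addnA.
by congr (m _ + m _ + m _)%N; apply: val_inj.
Qed.

Lemma mpolyX3 (m : 'X_{1..3}) :
  'X_[m] = 'X_i0 ^+ m i0 * 'X_i1 ^+ m i1 * 'X_i2 ^+ m i2 :> T.
Proof.
rewrite mpolyXE_id !big_ord_recl big_ord0 mulr1 mulrA.
rewrite (_ : lift ord0 ord0 = i1); last exact: val_inj.
rewrite (_ : lift ord0 (lift ord0 ord0) = i2); last exact: val_inj.
by rewrite (_ : ord0 = i0); last exact: val_inj.
Qed.

Lemma veronese_map_half (h0 h1 h2 : nat) :
  veronese_map (y00 ^+ h0 * y11 ^+ h1 * y22 ^+ h2) =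
  'X_i0 ^+ h0.*2 * 'X_i1 ^+ h1.*2 * 'X_i2 ^+ h2.*2.
Proof.
rewrite !rmorphM !rmorphXn /= !veronese_mapX !veronese_expE /nth !mpolyXD.
by rewrite -!muln2 !(mulnC _ 2%N) !exprM !expr2.
Qed.

Lemma half_homog (h0 h1 h2 : nat) :
  (y00 ^+ h0 * y11 ^+ h1 * y22 ^+ h2 : S) \is (h0 + h1 + h2).-homog.
Proof.
have H (i : 'I_6) h : ('X_i ^+ h : S) \is h.-homog.
  by rewrite -[X in X.-homog]mul1n dhomogMn // var_homog.
by rewrite !dhomogM.
Qed.

(** In even degree either no exponent or exactly two are odd; two odd ones supply one off-diagonal
    variable, and the rest is a product of squares. *)
Lemma even_monomial d (m : 'X_{1..3}) : mdeg m = d.*2 ->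
  exists2 p : S, p \is d.-homog & veronese_map p = 'X_[m].
Proof.
rewrite mdeg3 mpolyX3 -(odd_double_half (m i0)) -(odd_double_half (m i1)).
rewrite -(odd_double_half (m i2)).
move: (m i0)./2 (m i1)./2 (m i2)./2 => h0 h1 h2.
have H0 := half_homog h0 h1 h2.
have h1homog (i : 'I_6) d' : d' = (h0 + h1 + h2 + 1)%N ->
    (y00 ^+ h0 * y11 ^+ h1 * y22 ^+ h2 * 'X_i : S) \is d'.-homog.
  by move=> ->; rewrite dhomogM // var_homog.
case: (odd (m i0)) (odd (m i1)) (odd (m i2)) => [] [] [] E.
- by have := congr1 odd E; rewrite !(oddD, odd_double).
- exists (y00 ^+ h0 * y11 ^+ h1 * y22 ^+ h2 * y01); first by apply: h1homog;
    lia.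
  rewrite rmorphM /= veronese_map_half veronese_mapX veronese_expE /nth mpolyXD.
  by rewrite !exprD; ring.
- exists (y00 ^+ h0 * y11 ^+ h1 * y22 ^+ h2 * y02); first by apply: h1homog;
    lia.
  rewrite rmorphM /= veronese_map_half veronese_mapX veronese_expE /nth mpolyXD.
  by rewrite !exprD; ring.
- by have := congr1 odd E; rewrite !(oddD, odd_double).
- exists (y00 ^+ h0 * y11 ^+ h1 * y22 ^+ h2 * y12); first by apply: h1homog;
    lia.
  rewrite rmorphM /= veronese_map_half veronese_mapX veronese_expE /nth mpolyXD.
  by rewrite !exprD; ring.
- by have := congr1 odd E; rewrite !(oddD, odd_double).
- by have := congr1 odd E; rewrite !(oddD, odd_double).
exists (y00 ^+ h0 * y11 ^+ h1 * y22 ^+ h2).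
  by rewrite (_ : d = h0 + h1 + h2)%N //; lia.
by rewrite veronese_map_half.
Qed.

Lemma even_surjective d (q : T) : q \is d.*2.-homog ->
  exists2 p : S, p \is d.-homog & veronese_map p = q.
Proof.
move=> /dhomogP hq.
have /choice[P PE] m : exists p : S, m \in msupp q ->
    p \is d.-homog /\ veronese_map p = 'X_[m].
  have [/hq/even_monomial[p]|] := boolP (m \in msupp q); first by exists p.
  by exists 0.
exists (\sum_(m <- msupp q) q@_m *: P m).
  by rewrite big_seq rpred_sum // => m /PE[hp _]; rewrite dhomogZ.
rewrite [RHS]mpolyE (raddf_sum veronese_map) !big_seq;
  apply: eq_bigr => m /PE[_ <-].
by rewrite /= -!mul_mpolyC rmorphM /= veronese_mapC.
Qed.

Lemma odd_evalD (y y' : 'rV[S]_3) :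
  odd_eval (y + y') = odd_eval y + odd_eval y'.
Proof.
by rewrite /odd_eval -big_split; apply: eq_bigr => i _ /=;
  rewrite mxE rmorphD mulrDl.
Qed.

Lemma odd_evalZ (p : S) (y : 'rV[S]_3) :
  odd_eval (p *: y) = veronese_map p * odd_eval y.
Proof.
by rewrite /odd_eval mulr_sumr; apply: eq_bigr => i _;
  rewrite mxE rmorphM mulrA.
Qed.

(* A monomial of odd degree is a variable times a monomial of even degree. *)
Lemma odd_surjective d (q : T) : q \is (d.*2.+1).-homog ->
  exists y : 'rV[S]_3, odd_eval y = q.
Proof.
move=> /dhomogP hq.
have odd_mon m : m \in msupp q ->
      exists y : 'rV[S]_3, odd_eval y = 'X_[m].
  move=> /hq md'; have {md'}md : mdeg m = d.*2.+1 := md'.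
  have [i mi] : exists i, m i != 0%N.
    apply/existsP; rewrite -[X in is_true X]negbK negb_exists; apply/negP.
    move/forallP => m0; suff m00 : m = 0%MM by rewrite m00 mdeg0 in md.
    by apply/mnmP => i; rewrite mnm0E; apply/eqP/negPn/m0.
  have mE : m = ((m - U_(i)) + U_(i))%MM by rewrite submK // lep1mP.
  have [|p _ pE] := @even_monomial d (m - U_(i))%MM.
    by apply: succn_inj; rewrite -md [in RHS]mE mdegD mdeg1 addn1.
  exists (p *: delta_mx 0 i); rewrite odd_evalZ pE [in RHS]mE mpolyXD;
    congr (_ * _).
  rewrite /odd_eval (bigD1 i) //= mxE !eqxx rmorph1 mul1r big1 ?addr0 // =>
    j ji.
  by rewrite mxE (negPf ji) rmorph0 mul0r.
have /choice[Y YE] m :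
    exists y : 'rV[S]_3, m \in msupp q -> odd_eval y = 'X_[m].
  by have [/odd_mon[y]|] := boolP (m \in msupp q); [exists y | exists 0].
have eval0 : odd_eval (0 : 'rV[S]_3) = 0.
  by rewrite /odd_eval big1 // => i _; rewrite mxE rmorph0 mul0r.
exists (\sum_(m <- msupp q) (q@_m)%:MP *: Y m).
rewrite (big_morph _ odd_evalD eval0) [in RHS](mpolyE q) !big_seq.
by apply: eq_bigr => m /YE mE; rewrite odd_evalZ mE veronese_mapC mul_mpolyC.
Qed.

Local Notation X3 := (\col_i 'X_i : 'cV[T]_3).

Lemma col_vars : X3 = mxseq 3 1 [:: [:: 'X_i0]; [:: 'X_i1]; [:: 'X_i2]].
Proof.
apply/matrixP => i j; rewrite !mxE ord1.
by case: i => [[|[|[|//]]] i3] /=; congr 'X_(_); apply: val_inj.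
Qed.

Lemma odd_evalE (y : 'rV[S]_3) : odd_eval y = (map_mx veronese_map y *m X3) 0 0.
Proof. by rewrite mxE; apply: eq_bigr => i _; rewrite !mxE. Qed.

Lemma veronese_map_M1 : map_mx veronese_map M1 = 0.
Proof.
rewrite map_vmx1 /= !veronese_mapX !veronese_expE /nth !mpolyXD.
exact: vmx1_veronese.
Qed.

Lemma veronese_map_M3T : map_mx veronese_map M3^T *m X3 = 0.
Proof.
rewrite -map_trmx map_vmx3 /= !veronese_mapX !veronese_expE /nth !mpolyXD
  col_vars.
exact: vmx3_tr_veronese.
Qed.

Lemma meval_scale n d (g : {mpoly k[n]}) c (v : 'I_n -> k) : g \is d.-homog ->
  g.@[fun i => c * v i] = c ^+ d * g.@[v].
Proof.
move=> /dhomogP hg; rewrite !mevalE mulr_sumr !big_seq;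
  apply: eq_bigr => m /hg md.
rewrite mulrCA; congr (_ * _); under eq_bigr do rewrite exprMn.
by rewrite big_split /= prodrXr -mdegE; congr (_ ^+ _ * _); exact: md.
Qed.

Lemma mulmx_homog m1 m2 m3 d e (A : 'M[S]_(m1, m2)) (B : 'M[S]_(m2, m3)) :
  (forall i j, A i j \is d.-homog) -> (forall i j, B i j \is e.-homog) ->
  forall i j, (A *m B) i j \is (d + e).-homog.
Proof. by move=> hA hB i j; rewrite mxE rpred_sum // => l _;
  rewrite dhomogM. Qed.

Lemma veronese_map_homog d (p : S) :
  p \is d.-homog -> veronese_map p \is d.*2.-homog.
Proof.
have vX (m : 'X_{1..6}) : veronese_map 'X_[m] \is (mdeg m).*2.-homog.
  elim/mnm_ind: m => [|i m IHm]; first by rewrite mpolyX0 rmorph1 mdeg0 dhomog1.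
  rewrite mpolyXD rmorphM mdegD mdeg1 doubleD dhomogM //= veronese_mapX dhomogX
    /=.
  by move: i; apply: ord6_ind; rewrite veronese_expE /= mdegD !mdeg1.
move=> /dhomogP hp; rewrite [p]mpolyE (raddf_sum veronese_map) big_seq.
apply: rpred_sum => m /hp md; rewrite /= -mul_mpolyC rmorphM /= veronese_mapC.
by rewrite mul_mpolyC dhomogZ // -md.
Qed.

End Veronese_surface.

(** * The mapping cone *)

Section Mapping_cone.
Variables (R : comNzRingType) (a0 a1 a2 a3 b0 b1 b2 b3 : nat).
Variables (A1 : 'M[R]_(a1, a0)) (A2 : 'M[R]_(a2, a1)) (A3 : 'M[R]_(a3, a2)).
Variables (B1 : 'M[R]_(b1, b0)) (B2 : 'M[R]_(b2, b1)) (B3 : 'M[R]_(b3, b2)).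
Variables (c0 : 'M[R]_(b0, a0)) (c1 : 'M[R]_(b1, a1)).
Variables (c2 : 'M[R]_(b2, a2)) (c3 : 'M[R]_(b3, a3)).
Hypotheses (BcA1 : B1 *m c0 = c1 *m A1) (BcA2 : B2 *m c1 = c2 *m A2).
Hypothesis BcA3 : B3 *m c2 = c3 *m A3.

(** Maps act on row vectors from the right. The signs on [c1] and [c3] alone make consecutive
    products cancel. *)
Definition cone1 : 'M_(a1 + b0, a0) := col_mx A1 c0.
Definition cone2 : 'M_(a2 + b1, a1 + b0) := block_mx A2 0 (- c1) B1.
Definition cone3 : 'M_(a3 + b2, a2 + b1) := block_mx A3 0 c2 B2.
Definition cone4 : 'M_(b3, a3 + b2) := row_mx (- c3) B3.

Hypotheses (A21 : A2 *m A1 = 0) (A32 : A3 *m A2 = 0).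
Hypotheses (B21 : B2 *m B1 = 0) (B32 : B3 *m B2 = 0).

Lemma cone21 : cone2 *m cone1 = 0.
Proof. by rewrite mul_block_col A21 mul0mx addr0 mulNmx BcA1 addNr col_mx0. Qed.

Lemma cone32 : cone3 *m cone2 = 0.
Proof.
rewrite mulmx_block A32 B21 !mulmxN BcA2 addrN !mul0mx !mulmx0 oppr0 !addr0.
by rewrite block_mx0.
Qed.

Lemma cone43 : cone4 *m cone3 = 0.
Proof. by rewrite mul_row_block mulNmx BcA3 addNr B32 mulmx0 addr0 row_mx0. Qed.

(** The second hypothesis says that [c0] induces an injection from the cokernel of [B1] to that of
    [A1], here multiplication by f on T_odd. *)
Lemma exact_cone21 : exact_mx A2 A1 ->
  (forall (x : 'rV_a1) (y : 'rV_b0), x *m A1 + y *m c0 = 0 -> in_rows B1 y) ->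
  exact_mx cone2 cone1.
Proof.
move=> exA exB y; rewrite -[y]hsubmxK mul_row_col => E.
have [z zE] := exB _ _ E; rewrite zE -mulmxA BcA1 mulmxA -mulmxDl in E.
have [t tE] := exA _ E; exists (row_mx t z).
by rewrite mul_row_block mulmx0 add0r -tE mulmxN addrK zE.
Qed.

Lemma exact_cone32 : exact_mx A3 A2 -> exact_mx B2 B1 -> exact_mx cone3 cone2.
Proof.
move=> exA exB y; rewrite -[y]hsubmxK mul_row_block mulmx0 add0r -[0]hsubmxK.
case/eq_row_mx; rewrite !linear0 => E /exB[z zE].
rewrite zE mulmxN -mulmxA BcA2 mulmxA -mulmxBl in E.
have [t tE] := exA _ E; exists (row_mx t z).
by rewrite mul_row_block mulmx0 add0r -tE subrK zE.
Qed.

Lemma exact_cone43 : (forall x : 'rV_a3, x *m A3 = 0 -> x = 0) ->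
  exact_mx B3 B2 -> exact_mx cone4 cone3.
Proof.
move=> injA exB y; rewrite -[y]hsubmxK mul_row_block mulmx0 add0r -[0]hsubmxK.
case/eq_row_mx; rewrite !linear0 => E /exB[z zE].
rewrite zE -mulmxA BcA3 mulmxA -mulmxDl in E.
exists z; rewrite mul_mx_row mulmxN zE; congr row_mx.
by apply/eqP; rewrite -addr_eq0; apply/eqP/injA.
Qed.

Lemma cone4_injective : (forall x : 'rV_b3, x *m B3 = 0 -> x = 0) ->
  forall x : 'rV_b3, x *m cone4 = 0 -> x = 0.
Proof.
move=> injB x; rewrite mul_mx_row -[0]hsubmxK => /eq_row_mx[_].
by rewrite linear0; exact: injB.
Qed.

End Mapping_cone.

(** * The curve *)

Section Curve.
Variable k : closedFieldType.
Local Notation S := {mpoly k[6]}.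
Local Notation T := {mpoly k[3]}.
Local Notation "''Y_' i" :=
  ('X_(@Ordinal 6 i isT) : S) (at level 8, i at level 2).
Local Notation y00 := 'Y_0.
Local Notation y01 := 'Y_1.
Local Notation y02 := 'Y_2.
Local Notation y11 := 'Y_3.
Local Notation y12 := 'Y_4.
Local Notation y22 := 'Y_5.
Local Notation M1 := (vmx1 y00 y11 y22 y12 y02 y01).
Local Notation M2 := (vmx2 y00 y11 y22 y12 y02 y01).
Local Notation M3 := (vmx3 y00 y11 y22 y12 y02 y01).
Local Notation X3 := (\col_i 'X_i : 'cV[T]_3).

Section Curve_ideal.
Variables (f : {mpoly k[3]}) (D : nat).
Hypotheses (fD : f \is D.-homog) (D1 : (1 < D)%N) (firr : irreducible_mpoly f).

Lemma vanishing_homogP (g : {mpoly k[6]}) d : g \is d.-homog ->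
  vanishing_homog f g <-> divides f (veronese_map g).
Proof.
move=> gd; split=> [[_ g0]|[h E]]; last first.
  split=> [|b [x [c [_ fx0 _ bE]]]]; first by exists d.
  rewrite (meval_eq g bE) (meval_scale _ _ gd) -meval_veronese E mevalM fx0.
  by rewrite !mulr0.
have firr' : irreducible f := firr.
have [f0 _ _] := firr.
(* The factor x0 supplies the vanishing at the origin, which is no point of the curve; primality of
   f removes it again. *)
have [|[h E]|//] := irreducible_prime (a := 'X_(@Ordinal 3 0 isT))
    (b := veronese_map g) (factorial_mpoly k 3) firr'.
  apply: Nullstellensatz_irreducible => // v fv; rewrite mevalM mevalXU.
  have [v0|v0] := boolP [forall i, v i == 0].
    by rewrite (eqP (forallP v0 _)) mul0r.
  rewrite meval_veronese g0 ?mulr0 //; exists v, 1; split=> //.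
  - by move: v0; rewrite negb_forall => /existsP[i vi]; exists i.
  - exact: oner_neq0.
  - by move=> i; rewrite mul1r.
(* If f divided x0, truncation below D would kill the multiple of f but keep x0, of degree 1 < D. *)
have := congr1 (trunc D) E; rewrite -{2}[D]add0n truncM //.
rewrite /trunc big_ord0 mul0r -/(trunc D _) (trunc_homog _ (var_homog k _)) D1.
by move/eqP; rewrite (negPf (var_neq0 _ _)).
Qed.

Hypothesis oddD : odd D.

Lemma vanishing_homog_factor (g : S) : vanishing_homog f g ->
  exists y : 'rV[S]_3, veronese_map g = odd_eval y * f.
Proof.
move=> vg; have [[d gd] _] := vg.
have /vanishing_homogP-/(_ d gd)[h E] := vg.
have vgd := veronese_map_homog gd.
have [lt_dD|le_Dd] := ltnP d.*2 D.
  (* A multiple of f of degree below D is 0. *)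
  exists 0; rewrite /odd_eval big1 ?mul0r => [|i _];
    last by rewrite mxE rmorph0 mul0r.
  have := congr1 (trunc D) E;
    rewrite -{2}[D]add0n truncM // (trunc_homog _ vgd) lt_dD => ->.
  by rewrite /trunc big_ord0 mul0r.
have oddB : odd (d.*2 - D) by rewrite oddB // odd_double oddD.
have [e eE] : exists e, (d.*2 - D = e.*2.+1)%N.
  by exists (d.*2 - D)./2; rewrite -[LHS]odd_double_half oddB.
(* The cofactor [h] is not known to be homogeneous; its component of odd degree 2d - D does the same
   job. *)
have [y yE] := @odd_surjective k e (pihomog mdeg e.*2.+1 h) (pihomogP _ _ _).
exists y; rewrite yE -(pihomog_dE vgd) E -(pihomogM _ _ fD).
by rewrite -eE subnK.
Qed.

Variables (c0 : 'cV[S]_3) (e : nat).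
Hypothesis c0_homog : forall i j, c0 i j \is e.-homog.
Hypothesis hc0 : map_mx (@veronese_map k) c0 = f *: X3.

Lemma veronese_map_cone1 (x : 'rV[S]_6) (y : 'rV[S]_3) :
  veronese_map ((x *m M1 + y *m c0) 0 0) = odd_eval y * f.
Proof.
have -> : veronese_map ((x *m M1 + y *m c0) 0 0) =
    (map_mx (@veronese_map k) (x *m M1 + y *m c0)) 0 0 by rewrite [RHS]mxE.
rewrite map_mxD !map_mxM /= veronese_map_M1 mulmx0 add0r hc0 -scalemxAr mxE.
by rewrite -odd_evalE mulrC.
Qed.

(** If phi(g) = f times the value of [y], then [g] and y c0 have the same image, so they differ by
    an element of ker phi, that is, by a combination of the minors. *)
Lemma curve_idealP (p : S) : (p \in ideal_gen (vanishing_homog f)) <->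
  exists (x : 'rV[S]_6) (y : 'rV[S]_3), p = (x *m M1 + y *m c0) 0 0.
Proof.
split=> [/asboolP[s [hs ->]]|[x [y ->]]].
  rewrite big_seq; elim/big_ind: _ => [|p1 p2 [x1 [z1 ->]] [x2 [z2 ->]]|g gs].
  - by exists 0, 0; rewrite !mul0mx addr0 mxE.
  - by exists (x1 + x2), (z1 + z2); rewrite !mulmxDl addrACA [RHS]mxE.
  have [y E] := vanishing_homog_factor (hs _ gs).
  have [x xE] : in_rows M1 (const_mx g.2 - y *m c0).
    apply: kernel_even; have := veronese_map_cone1 0 y;
      rewrite mul0mx add0r => yE.
    have -> : (const_mx g.2 - y *m c0) 0 0 = g.2 - (y *m c0) 0 0.
      by rewrite mxE [X in X + _]mxE [X in _ + X]mxE.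
    by rewrite rmorphB /= E yE subrr.
  exists (g.1 *: x), (g.1 *: y).
  by rewrite -!scalemxAl -xE -scalerDr subrK !mxE.
have gen (g : S) d : g \is d.-homog -> divides f (veronese_map g) ->
    g \in ideal_gen (vanishing_homog f).
  move=> gd /(vanishing_homogP gd) vg; apply/asboolP; exists [:: (1, g)].
  by rewrite big_seq1 mul1r; split=> // _ /[!inE]/eqP->.
rewrite [X in X \in _]mxE !mxE rpredD // rpred_sum // => i _;
  rewrite ideal_genMl //.
  apply: (gen _ 2); first exact: M1_homog.
  exists 0; rewrite mul0r.
  by have /matrixP/(_ i 0) := veronese_map_M1 k; rewrite !mxE.
apply: (gen _ e); first exact: c0_homog.
exists 'X_i; have /matrixP/(_ i 0) := hc0; rewrite !mxE => ->.
by rewrite mulrC.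
Qed.

End Curve_ideal.

(** The degrees are forced by the squares: 1 + m = (m - 1) + 2 for [c1], 1 + (m - 1) = (m - 1) + 1
    for [c2], and 2 + (m - 1) = m + 1 for [c3]. *)
Lemma comparison_maps (f : T) m : (2 <= m)%N -> f \is (2 * m - 1)%N.-homog ->
  exists (c0 : 'M[S]_(3, 1)) (c1 : 'M[S]_(8, 6)) (c2 : 'M[S]_(6, 8)) (c3 :
    'M[S]_(1, 3)),
    [/\ map_mx (@veronese_map k) c0 = f *: X3,
        M3^T *m c0 = c1 *m M1, M2^T *m c1 = c2 *m M2 & M1^T *m c2 = c3 *m M3] /\
    [/\ forall i j, c0 i j \is m.-homog, forall i j, c1 i j \is m.-1.-homog,
        forall i j, c2 i j \is m.-1.-homog & forall i j, c3 i j \is m.-homog].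
Proof.
move=> m2 fm.
have /choice[h hP] i : exists h : S, h \is m.-homog /\ veronese_map h = f *
  'X_i.
  have [|h] := @even_surjective k m (f * 'X_i); last by exists h.
  rewrite (_ : m.*2 = 2 * m - 1 + 1)%N; last by lia.
  by rewrite dhomogM // var_homog.
pose c0 : 'M[S]_(3, 1) := \col_i h i.
have c0E : map_mx (@veronese_map k) c0 = f *: X3.
  by apply/matrixP => i j; rewrite !mxE (hP i).2.
have c0_homog i j : c0 i j \is m.-homog by rewrite mxE (hP i).1.
have M1T_homog i j : M1^T i j \is 2.-homog by rewrite mxE M1_homog.
have M2T_homog i j : M2^T i j \is 1.-homog by rewrite mxE M2_homog.
have M3T_homog i j : M3^T i j \is 1.-homog by rewrite mxE M3_homog.
have [|i j|c1 c1E c1_homog] :=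
  @lift_homog k 6 1 8 m.-1 2 M1 (M3^T *m c0) (M1_homog k).
- move=> i; apply: kernel_even.
  have -> : veronese_map (row i (M3^T *m c0) 0 0) =
      map_mx (@veronese_map k) (M3^T *m c0) i 0
        by rewrite [RHS]mxE [row _ _ _ _]mxE.
  by rewrite map_mxM c0E -scalemxAr veronese_map_M3T scaler0 mxE.
- rewrite (_ : m.-1 + 2 = 1 + m)%N; last by lia.
  exact: mulmx_homog.
have [|i j|c2 c2E c2_homog] :=
  @lift_homog k 8 6 6 m.-1 1 M2 (M2^T *m c1) (M2_homog k).
- move=> i; apply: exact_M2_M1.
  by rewrite -row_mul -mulmxA -c1E mulmxA -trmx_mul vmx3_vmx2 trmx0 mul0mx row0.
- by rewrite addnC; apply: mulmx_homog.
have [|i j|c3 c3E c3_homog] :=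
  @lift_homog k 3 8 1 m 1 M3 (M1^T *m c2) (M3_homog k).
- move=> i; apply: exact_M3_M2.
  by rewrite -row_mul -mulmxA -c2E mulmxA -trmx_mul vmx2_vmx1 trmx0 mul0mx row0.
- rewrite (_ : m + 1 = 2 + m.-1)%N; last by lia.
  exact: mulmx_homog.
by exists c0, c1, c2, c3; split; split.
Qed.

(** The i-th basis vector lies in degree -s_i, where the j-th coordinate of the target is S in
    degree t_j - s_i. *)
Lemma degree0_mulmxr (s t : seq int) (M : 'M[S]_(size s, size t)) :
  (forall (i : 'I_(size s)) (j : 'I_(size t)),
    homog_part (t`_j - s`_i) (M i j)) ->
  @degree0 k 6 (gr_free k 6 s) (gr_free k 6 t) (mulmxr M).
Proof.
move=> hM e v hv j; rewrite /= mxE; elim/big_ind: _ => [|p q|i _].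
- exact: homog_part0.
- exact: homog_partD.
rewrite (_ : t`_j + e = (s`_i + e) + (t`_j - s`_i)); last by ring.
by apply: homog_partM; [exact: hv | exact: hM].
Qed.

Lemma exact_mxP m1 m2 m3 (A : 'M[S]_(m1, m2)) (B : 'M[S]_(m2, m3)) :
  A *m B = 0 -> exact_mx A B ->
  forall y : 'rV_m2, y *m B = 0 <-> exists x, x *m A = y.
Proof.
move=> AB exAB y; split=> [/exAB[z ->]|[x <-]]; first by exists z.
by rewrite -mulmxA AB mulmx0.
Qed.

Lemma homog_part_dhomog e d (p : S) :
  p \is d.-homog -> e = d%:Z -> homog_part e p.
Proof. by move=> hp ->. Qed.

Lemma nth_nseq2 p q (x y : int) (i : 'I_(p + q)) :
  (nseq p x ++ nseq q y)`_i = match split i with inl _ => x | inr _ => y end.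
Proof.
rewrite nth_cat size_nseq !nth_nseq; case: splitP => j ij //.
by rewrite ij addKn ltn_ord.
Qed.

(** The last free module is the ring itself, not rows of length one, so the single entry is
    extracted. *)
Definition row_eval n (M : 'M[S]_(n, 1)) (v : 'rV[S]_n) : S^o := (v *m M) 0 0.

Lemma row_eval_is_linear n (M : 'M[S]_(n, 1)) : linear (row_eval M).
Proof. by move=> p u v; rewrite /row_eval mulmxDl -scalemxAl !mxE. Qed.

HB.instance Definition _ n (M : 'M[S]_(n, 1)) :=
  GRing.isLinear.Build S 'rV[S]_n S^o _ (row_eval M) (row_eval_is_linear M).

Lemma degree0_row_eval (s : seq int) (M : 'M[S]_(size s, 1)) :
  (forall i : 'I_(size s), homog_part (- s`_i) (M i 0)) ->
  @degree0 k 6 (gr_free k 6 s) (gr_ring k 6) (row_eval M).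
Proof.
move=> hM e v hv; rewrite /row_eval /= mxE; elim/big_ind: _ => [|p q|i _].
- exact: homog_part0.
- exact: homog_partD.
rewrite (_ : e = (s`_i + e) + (- s`_i)); last by ring.
by apply: homog_partM; [exact: hv | exact: hM].
Qed.

Lemma resolution_matrices (f : T) m : (2 <= m)%N ->
  f \is (2 * m - 1)%N.-homog -> irreducible_mpoly f ->
  let s1 := nseq 6 (- 2%:Z) ++ nseq 3 (- m%:Z) in
  let s2 := nseq 8 (- 3%:Z) ++ nseq 8 (- m%:Z - 1) in
  let s3 := nseq 3 (- 4%:Z) ++ nseq 6 (- m%:Z - 2%:Z) in
  let s4 := nseq 1 (- m%:Z - 4%:Z) in
  exists (d4 : 'M[S]_(1, 3 + 6)) (d3 : 'M[S]_(3 + 6, 8 + 8))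
    (d2 : 'M[S]_(8 + 8, 6 + 3)) (d1 : 'M[S]_(6 + 3, 1)),
    [/\ forall i j, homog_part (s3`_(j : 'I__) - s4`_(i : 'I__)) (d4 i j),
        forall i j, homog_part (s2`_(j : 'I__) - s3`_(i : 'I__)) (d3 i j),
        forall i j, homog_part (s1`_(j : 'I__) - s2`_(i : 'I__)) (d2 i j)
      & forall i, homog_part (- s1`_(i : 'I__)) (d1 i 0)] /\
    [/\ forall x : 'rV_1, x *m d4 = 0 -> x = 0,
        exact_mx d4 d3, exact_mx d3 d2 & exact_mx d2 d1] /\
    [/\ d4 *m d3 = 0, d3 *m d2 = 0 & d2 *m d1 = 0] /\
    forall p, p \in ideal_gen (vanishing_homog f) <->
      exists v : 'rV_(6 + 3), p = (v *m d1) 0 0.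
Proof.
move=> m2 fm firr s1 s2 s3 s4.
have [c0 [c1 [c2 [c3 [[c0E c1E c2E c3E] [h0 h1 h2 h3]]]]]] :=
  comparison_maps m2 fm.
have D1 : (1 < 2 * m - 1)%N by lia.
have oddD : odd (2 * m - 1) by lia.
have M1T_homog i j : M1^T i j \is 2.-homog by rewrite mxE M1_homog.
have M2T_homog i j : M2^T i j \is 1.-homog by rewrite mxE M2_homog.
have M3T_homog i j : M3^T i j \is 1.-homog by rewrite mxE M3_homog.
exists (cone4 M1^T c3), (cone3 M3 M2^T c2), (cone2 M2 M3^T c1), (cone1 M1 c0).
split; [split|split; [split|split; [split|]]].
- move=> i j; rewrite nth_nseq2 ord1 /= !mxE; case: split => l.
    by rewrite mxE; apply: (@homog_part_dhomog _ m); rewrite ?dhomogN //; lia.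
  by apply: (@homog_part_dhomog _ 2); rewrite // ; lia.
- move=> i j; rewrite !nth_nseq2 !mxE; case: (split i) => l; rewrite mxE;
    case: (split j) => l'.
  + by apply: (@homog_part_dhomog _ 1); [exact: M3_homog|lia].
  + by rewrite mxE; exact: homog_part0.
  + by apply: (@homog_part_dhomog _ m.-1); [exact: h2|lia].
  + by apply: (@homog_part_dhomog _ 1); [exact: M2T_homog|lia].
- move=> i j; rewrite !nth_nseq2 !mxE; case: (split i) => l; rewrite mxE;
    case: (split j) => l'.
  + by apply: (@homog_part_dhomog _ 1); [exact: M2_homog|lia].
  + by rewrite mxE; exact: homog_part0.
  + by rewrite mxE; apply: (@homog_part_dhomog _ m.-1); [rewrite dhomogN;
      exact: h1|lia].
  + by apply: (@homog_part_dhomog _ 1); [exact: M3T_homog|lia].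
- move=> i; rewrite !nth_nseq2 !mxE; case: split => l.
    by apply: (@homog_part_dhomog _ 2); [exact: M1_homog|lia].
  by apply: (@homog_part_dhomog _ m); [exact: h0|lia].
- exact: cone4_injective (@M1T_injective k).
- exact: exact_cone43 c3E (@M3_injective k) (@exact_M1T_M2T k).
- exact: exact_cone32 c2E (@exact_M3_M2 k) (@exact_M2T_M3T k).
(* Applying phi to the relation leaves f times the value of [y], and f is nonzero in the domain
   T. *)
- apply: exact_cone21 c1E (@exact_M2_M1 k) _ => x y E; apply: kernel_odd.
  have := veronese_map_cone1 c0E x y; rewrite E mxE rmorph0 => /esym/eqP.
  by rewrite mulf_eq0 (negPf (let: And3 f0 _ _ := firr in f0)) orbF => /eqP.
- by apply: cone43 c3E _; rewrite -trmx_mul vmx2_vmx1 trmx0.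
- by apply: cone32 c2E _ _; rewrite ?vmx3_vmx2 // -trmx_mul vmx3_vmx2 trmx0.
- by apply: cone21 c1E _; rewrite vmx2_vmx1.
move=> p; rewrite (curve_idealP fm D1 firr oddD h0 c0E); split.
  by move=> [x [y ->]]; exists (row_mx x y); rewrite mul_row_col.
by move=> [v ->]; exists (lsubmx v), (rsubmx v); rewrite -mul_row_col hsubmxK.
Qed.

End Curve.

Theorem theorem7 (k : closedFieldType) (m : nat) (hm : (2 <= m)%N)
    (f : {mpoly k[3]}) (fhomog : f \is (2 * m - 1)%N.-homog)
    (firr : irreducible_mpoly f) :
  let F0 := gr_ring k 6 in
  let F1 := gr_free k 6 (nseq 6 (- 2%:Z) ++ nseq 3 (- m%:Z)) in
  let F2 := gr_free k 6 (nseq 8 (- 3%:Z) ++ nseq 8 (- m%:Z - 1)) in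
  let F3 := gr_free k 6 (nseq 3 (- 4%:Z) ++ nseq 6 (- m%:Z - 2%:Z)) in
  let F4 := gr_free k 6 (nseq 1 (- m%:Z - 4%:Z)) in
  exists (beta4 : {linear F4 -> F3}) (beta3 : {linear F3 -> F2})
         (beta2 : {linear F2 -> F1}) (beta1 : {linear F1 -> F0}),
    [/\ degree0 beta4, degree0 beta3, degree0 beta2, degree0 beta1
      & degree0 (curve_proj f)] /\
    [/\ injective beta4,
        exact_at beta4 beta3,
        exact_at beta3 beta2
      & exact_at beta2 beta1] /\
    exact_at beta1 (curve_proj f) /\
    (forall y : curve_ring f, exists x : F0, curve_proj f x = y).
Proof.
have [d4 [d3 [d2 [d1 [[h4 h3 h2 h1] [[inj4 ex43 ex32 ex21] [[d43 d32 d21]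
  idP]]]]]]] :=
  resolution_matrices hm fhomog firr.
move=> F0 F1 F2 F3 F4.
pose beta4 : {linear F4 -> F3} := mulmxr d4.
pose beta3 : {linear F3 -> F2} := mulmxr d3.
pose beta2 : {linear F2 -> F1} := mulmxr d2.
pose beta1 : {linear F1 -> F0} := row_eval d1.
exists beta4, beta3, beta2, beta1.
split; [split|split; [split|split]].
- exact: degree0_mulmxr.
- exact: degree0_mulmxr.
- exact: degree0_mulmxr.
- exact: degree0_row_eval.
- by move=> e x xe; exists x.
- move=> x y; rewrite /beta4 /= => E; apply/eqP; rewrite -subr_eq0;
    apply/eqP/inj4.
  by rewrite mulmxBl E subrr.
- exact: exact_mxP d43 ex43.
- exact: exact_mxP d32 ex32.
- move=> y; apply: iff_trans (exact_mxP d21 ex21 y); split=> [y0|y0].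
    by apply/rowP => i; rewrite ord1 [RHS]mxE.
  by rewrite /beta1 /= /row_eval y0 mxE.
- move=> y; apply: (@iff_trans _ (y \in ideal_gen (vanishing_homog f))).
    by rewrite -[y in X in _ <-> X]subr0 -quot_proj_eq raddf0.
  by rewrite idP; split=> [[v ->]|[v <-]]; exists v.
by move=> y; exists (repr (y : {ideal_quot _})); exact: quot_projK.
Qed.
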